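(* For every integer $k\ge 0$, one has $Z^{\mathcal F}_k=Z_k$ as $\mathbb{Q}$-linear subspaces of $\mathbb{R}$. That is, the $\mathbb{Q}$-vector space generated by the finite real multiple zeta values $\zeta^{\mathcal F}(\mathbf{k})$, with $\mathbf{k}$ running over all (not necessarily admissible) indices of weight $k$, coincides with the $\mathbb{Q}$-vector space generated by the multiple zeta values $\zeta(\mathbf{k})$, with $\mathbf{k}$ running over all admissible indices of weight $k$.
   Context: An index is a finite (possibly empty) tuple $\mathbf{k}=(k_1,\ldots,k_n)$ of positive integers; $n$ is its depth and $|\mathbf{k}|=k_1+\cdots+k_n$ its weight (the empty index $\emptyset$ has depth $0$ and weight $0$). An index is admissible if it is empty or $k_n\ge 2$. For an admissible index, the multiple zeta value is $\zeta(\mathbf{k})=\sum_{0<m_1<\cdots<m_n}\frac{1}{m_1^{k_1}\cdots m_n^{k_n}}\in\mathbb{R}$, with $\zeta(\emptyset)=1$. $Z_k$ is the $\mathbb{Q}$-linear subspace of $\mathbb{R}$ spanned by the multiple zeta values $\zeta(\mathbf{k})$ with $\mathbf{k}$ admissible of weight $k$ (so $Z_0=\mathbb{Q}$, $Z_1=0$). For any (not necessarily admissible) index $\mathbf{k}=(k_1,\ldots,k_n)$, the finite real multiple zeta value (regularized with respect to the series expression) is the limit, which exists in $\mathbb{R}$, $$\zeta^{\mathcal F}(\mathbf{k})=\lim_{M\to\infty}\ \sum_{\substack{m_1,\ldots,m_n\in\mathbb{Z}\\ 0<|m_1|,\ldots,|m_n|<M\\ \frac1{m_1}>\cdots>\frac1{m_n}}}\frac{1}{m_1^{k_1}\cdots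 m_n^{k_n}},$$ with $\zeta^{\mathcal F}(\emptyset)=1$. $Z^{\mathcal F}_k$ is the $\mathbb{Q}$-linear span of all $\zeta^{\mathcal F}(\mathbf{k})$ with $|\mathbf{k}|=k$. *)

(* Defs.v *)
(* The field of real numbers is an arbitrary [R : realType] (unique up to
   isomorphism). *)
From HB Require Import structures.
From mathcomp Require Import all_boot all_order all_algebra.
From mathcomp Require Import all_classical all_reals all_analysis.

Set Implicit Arguments.
Unset Strict Implicit.
Unset Printing Implicit Defensive.

Import Order.TTheory GRing.Theory Num.Theory.
Import numFieldNormedType.Exports.

Local Open Scope classical_set_scope.
Local Open Scope ring_scope.

Definition is_index (k : seq nat) : bool := all (fun a => 0 < a)%N k.

Definition depth (k : seq nat) : nat := size k.

Definition weight (k : seq nat) : nat := sumn k.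

Definition admissible (k : seq nat) : bool :=
  is_index k && ((k == [::]) || (2 <= last 0 k)%N).

Definition mzv_dom (n : nat) : set (n.-tuple nat) :=
  [set m | (forall i, (0 < tnth m i)%N) /\ sorted ltn m].

Arguments mzv_dom : clear implicits.

(* A sum of nonnegative terms, hence an unordered sum in [\bar R]; it is finite
   for admissible [k], so that [fine] loses nothing there. *)
Definition mzv (R : realType) (k : seq nat) : R :=
  fine (\esum_(m in mzv_dom (depth k))
    ((\prod_(i < depth k) (tnth m i)%:R ^+ nth 0%N k i)^-1)%:E).

Definition mzvF_dom (n M : nat) : set (n.-tuple int) :=
  [set m | (forall i, 0 < `|tnth m i| < M%:Z) /\
           sorted (fun a b : int => (a%:Q)^-1 > (b%:Q)^-1) m].

Arguments mzvF_dom : clear implicits.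

(* [mzvF_dom n M] is a finite set, so [\sum_(_ \in _)] is the plain sum. *)
Definition mzvF_trunc (R : realType) (k : seq nat) (M : nat) : R :=
  \sum_(m \in mzvF_dom (depth k) M)
    ((\prod_(i < depth k) (tnth m i)%:~R ^+ nth 0%N k i)^-1 : R).

Definition mzvF (R : realType) (k : seq nat) : R :=
  limn (mzvF_trunc R k).

Definition Qspan (R : realType) (S : set R) : set R :=
  [set x | exists s : seq (rat * R),
     (forall p, p \in s -> S p.2) /\ x = \sum_(p <- s) ratr p.1 * p.2].

Definition mzv_space (R : realType) (w : nat) : set R :=
  Qspan [set mzv R k | k in [set k | admissible k /\ weight k = w]].

Arguments mzv_space : clear implicits.

Definition mzvF_space (R : realType) (w : nat) : set R :=
  Qspan [set mzvF R k | k in [set k | is_index k /\ weight k = w]].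

Arguments mzvF_space : clear implicits.

(* Main.v *)
(* Every zeta^F(k) is a limit of the sums over i of +-S_M(k_1..k_i)
   S_M(k_n..k_(i+1)), where S_M is the truncated multiple zeta sum. Expanding
   S_M in the sums S_M(1,..,1) with shuffle-regularized multiple zeta values
   as coefficients, the divergent parts recombine into the truncated
   zeta^F(1,..,1), which tends to 0 or to +-zeta(2,..,2). Hence zeta^F(k)
   lies in Z, and modulo products it is zeta(k) + (-1)^|k| zeta(k reversed).

   Conversely, by induction on the weight w and since the zeta^F form an
   algebra (stuffle product), one may work in the quotient of R by Z^F_w,
   where proper products of weight w vanish. Let g be the image there of the
   regularized iterated integrals of the words of length w in two letters. It
   kills proper shuffles, so reversing a word only changes the sign of g by
   (-1)^(w-1); with the relation above, g(e_1 u) = g(u e_1), and by duality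
   also g(e_0 u) = g(u e_0). So g is invariant under rotation. The shuffle of
   a letter a with v, written with a rotated to the front, then says that g(a
   v) plus the sum of g(a v') over the w - 1 rotations v' of v vanishes;
   summing over the rotations of v gives g = 0. *)
Require Import Defs.
From HB Require Import structures.
From mathcomp Require Import all_boot all_order all_algebra.
From mathcomp Require Import all_classical all_reals all_analysis.
From mathcomp Require Import ring_quotient ring lra zify.

Set Implicit Arguments.
Unset Strict Implicit.
Unset Printing Implicit Defensive.

Import Order.TTheory GRing.Theory Num.Theory.
Import numFieldNormedType.Exports.

Local Open Scope classical_set_scope.
Local Open Scope ring_scope.

(** * The shuffle product *)

(** No integral occurs: a word stands for the power series of its multiple polylogarithm. The
    shuffle relation then comes from Leibniz's rule for z d/dz on coefficients, and duality, usually
    the substitution z -> 1 - z, from rearranging a connected double series. The obstacle is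
    divergence: in the sums over the cut i both factors may grow like powers of log M, so an error
    has to stay small after multiplication by any such power. Hence [negligible] in place of
    convergence to 0. Duality is available for convergent words only; but a functional that kills
    the insertions of a letter and vanishes on those words vanishes on all, so modulo products
    duality holds everywhere. Expressing divergent words by others, and the final count of
    rotations, divide by positive integers only, so a torsion-free abelian group serves as the
    quotient. *)

Section Shuffle.
Variable T : eqType.
Implicit Types (u v w x y z : seq T) (a b : T).

Fixpoint shuffle u : seq T -> seq (seq T) :=
  if u is a :: u' then
    fix shuffle' v := if v is b :: v' then
      map (cons a) (shuffle u' v) ++ map (cons b) (shuffle' v') else [:: u]
  else fun v => [:: v].

#[local] Arguments shuffle : simpl never.

Lemma sh_nil u : shuffle u [::] = [:: u].
Proof. by case: u. Qed.

Lemma sh_cons a u b v :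
  shuffle (a :: u) (b :: v) =
  map (cons a) (shuffle u (b :: v)) ++ map (cons b) (shuffle (a :: u) v).
Proof. by []. Qed.

Lemma sh_ind (P : seq T -> seq T -> Prop) :
  (forall v, P [::] v) -> (forall u, P u [::]) ->
  (forall a u b v, P u (b :: v) -> P (a :: u) v -> P (a :: u) (b :: v)) ->
  forall u v, P u v.
Proof.
move=> H0 H1 H2; elim=> [//|a u IHu]; elim=> [//|b v IHv].
by apply: H2.
Qed.

Lemma size_sh u v x : x \in shuffle u v -> size x = (size u + size v)%N.
Proof.
move: u v x; apply: sh_ind => [v x|u x|a u b v IH1 IH2 x].
- by rewrite /shuffle /= inE => /eqP->.
- by rewrite sh_nil inE => /eqP->; rewrite addn0.
- rewrite sh_cons mem_cat => /orP[] /mapP[y /[swap] -> /=].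
    by move=> /IH1 ->; rewrite addSn.
  by move=> /IH2 ->; rewrite /= addnS.
Qed.

(** With default [d], the condition [last d u = d] means that [u] is empty or ends in [d]; [h1] is
    of this form. *)
Lemma last_sh d u v x : last d u = d -> last d v = d -> x \in shuffle u v ->
  last d x = d.
Proof.
move: u v x; apply: sh_ind => [v x _ Hv|u x Hu _|a u b v IH1 IH2 x].
- by rewrite /shuffle /= inE => /eqP->.
- by rewrite sh_nil inE => /eqP->.
- have lastE e y : last d (e :: y) = d -> last d y = d by case: y.
  move=> Hu Hv; rewrite sh_cons mem_cat => /orP[] /mapP[y yin ->] /=.
    have := IH1 y (lastE _ _ Hu) Hv yin; have := size_sh yin.
    by case: y {yin} => //=; rewrite addnS.
  have := IH2 y Hu (lastE _ _ Hv) yin; have := size_sh yin.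
  by case: y {yin}.
Qed.

Variable V : nmodType.
Implicit Type f : seq T -> V.

Lemma sum_sh0s v f : \sum_(x <- shuffle [::] v) f x = f v.
Proof. by rewrite big_seq1. Qed.

Lemma sum_shs0 u f : \sum_(x <- shuffle u [::]) f x = f u.
Proof. by rewrite sh_nil big_seq1. Qed.

Lemma sum_sh_cons a u b v f :
  \sum_(x <- shuffle (a :: u) (b :: v)) f x =
  \sum_(x <- shuffle u (b :: v)) f (a :: x) + \sum_(x <- shuffle (a :: u) v) f
    (b :: x).
Proof. by rewrite sh_cons big_cat !big_map. Qed.

(** A list of words plays the part of a formal sum: once an arbitrary [f] is summed over it, the
    order of the list no longer matters. *)
Lemma sum_shC u v f : \sum_(x <- shuffle u v) f x = \sum_(x <- shuffle v u) f x.
Proof.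
move: u v f; apply: sh_ind => [v f|u f|a u b v IH1 IH2 f].
- by rewrite sum_sh0s sum_shs0.
- by rewrite sum_sh0s sum_shs0.
- by rewrite !sum_sh_cons IH1 IH2 addrC.
Qed.

(** Both sides are sorted by the first letter of the final word; each of the three classes is an
    instance for shorter words, hence the induction on the total length. *)
Lemma sum_shA u v w f :
  \sum_(y <- shuffle u v) \sum_(z <- shuffle y w) f z =
  \sum_(y <- shuffle v w) \sum_(z <- shuffle u y) f z.
Proof.
have [n] := ubnP (size u + size v + size w)%N.
elim: n u v w f => // n IH [|a u] v w f.
  by move=> _; rewrite sum_sh0s; under [RHS]eq_bigr do rewrite sum_sh0s.
case: v => [|b v] => [_|]; first by rewrite sum_shs0 sum_sh0s.
case: w => [|c w] => [_|].
  by rewrite sum_shs0; under [LHS]eq_bigr do rewrite sum_shs0.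
rewrite /= => Hn.
rewrite !sum_sh_cons.
under eq_bigr do rewrite sum_sh_cons.
under [X in _ + X = _]eq_bigr do rewrite sum_sh_cons.
under [X in _ = X + _]eq_bigr do rewrite sum_sh_cons.
under [X in _ = _ + X]eq_bigr do rewrite sum_sh_cons.
rewrite !big_split /=.
have E1 := IH u (b :: v) (c :: w) (fun z => f (a :: z)).
have E2 := IH (a :: u) v (c :: w) (fun z => f (b :: z)).
have E3 := IH (a :: u) (b :: v) w (fun z => f (c :: z)).
rewrite /= in E1 E2 E3.
rewrite E1 ?E2; try by move: Hn; rewrite /= ?addSn ?addnS ?addSn ?addnS ?ltnS.
have {}E3 := E3 _.
rewrite sum_sh_cons in E3.
rewrite sum_sh_cons.
rewrite addrACA [in LHS]E3.
  by rewrite -!addrA; congr (_ + _); rewrite addrCA.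
by move: Hn; rewrite /= ?addSn ?addnS ?addSn ?addnS ?ltnS.
Qed.

Lemma sum_sh_rcons u a v b f :
  \sum_(x <- shuffle (rcons u a) (rcons v b)) f x =
  \sum_(x <- shuffle u (rcons v b)) f (rcons x a) +
  \sum_(x <- shuffle (rcons u a) v) f (rcons x b).
Proof.
move: u v f; apply: sh_ind => [v f|u f|c u d v IH1 IH2 f].
- elim: v f => [|d v IH] f.
    by rewrite /= sum_sh_cons !sum_sh0s /= addrC.
  rewrite rcons_cons /= sum_sh_cons !sum_sh0s IH sum_sh_cons !sum_sh0s.
  by rewrite addrCA.
- elim: u f => [|d u IH] f.
    by rewrite /= sum_sh_cons !sum_sh0s /= addrC.
  rewrite rcons_cons /= sum_sh_cons !sum_shs0 IH sum_sh_cons !sum_shs0 /=.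
  by rewrite addrAC.
- rewrite !rcons_cons sum_sh_cons -rcons_cons IH1 -rcons_cons IH2.
  by rewrite !rcons_cons !sum_sh_cons addrACA.
Qed.

Lemma sum_sh_rev u v f :
  \sum_(x <- shuffle (rev u) (rev v)) f x = \sum_(x <- shuffle u v) f (rev x).
Proof.
move: u v f; apply: sh_ind => [v f|u f|a u b v IH1 IH2 f].
- by rewrite !sum_sh0s.
- by rewrite !sum_shs0.
- rewrite !rev_cons sum_sh_rcons sum_sh_cons -rev_cons IH1 -rev_cons IH2.
  by congr (_ + _); apply: eq_bigr => x _; rewrite rev_cons.
Qed.

Lemma sum_sh_nseq m n a f :
  \sum_(x <- shuffle (nseq m a) (nseq n a)) f x =
    f (nseq (m + n) a) *+ 'C(m + n, m).
Proof.
elim: m n f => [|m IHm] n f; first by rewrite sum_sh0s bin0.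
elim: n f => [|n IHn] f; first by rewrite sum_shs0 addn0 binn.
rewrite [nseq m.+1 a]/= [nseq n.+1 a]/= sum_sh_cons (IHm n.+1) (IHn _).
by rewrite !addSn addnS -mulrnDr; congr (_ *+ _); rewrite [RHS]binS addnC.
Qed.

Lemma sum_ins_nseq n a u f :
  \sum_(x <- shuffle [:: a] (nseq n a ++ u)) f x =
  f (a :: nseq n a ++ u) *+ n + \sum_(x <- shuffle [:: a] u) f (nseq n a ++ x).
Proof.
elim: n f => [|n IH] f; first by rewrite /= mulr0n add0r.
by rewrite [nseq n.+1 a ++ u]/= sum_sh_cons sum_sh0s IH /= mulrS addrA.
Qed.

End Shuffle.

Lemma sum_sh_map (T1 T2 : eqType) (h : T1 -> T2) (V : nmodType) u v
    (f : seq T2 -> V) :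
  \sum_(x <- shuffle (map h u) (map h v)) f x =
    \sum_(x <- shuffle u v) f (map h x).
Proof.
move: u v f; apply: sh_ind => [v f|u f|a u b v IH1 IH2 f].
- by rewrite !sum_sh0s.
- by rewrite !sum_shs0.
- by rewrite /= !sum_sh_cons -/(map h (b :: v)) -/(map h (a :: u)) IH1 IH2.
Qed.

Section Antipode.
Variables (T : eqType) (V : zmodType) (g : seq T -> V) (w : nat).
Hypothesis g_sh : forall u v, u != [::] -> v != [::] ->
  (size u + size v = w)%N -> \sum_(x <- shuffle u v) g x = 0.

(* Groups the words of [shuffle (a :: p) (b :: q)] by their first letter. *)
Lemma sh_antipode a p q : (size p + size q).+1 = w ->
  \sum_(y <- shuffle p q) g (a :: y) = g (rev q ++ a :: p) *~ (-1) ^+ size q.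
Proof.
elim: q a p => [|b q IH] a p Hw; first by rewrite sum_shs0 expr0.
have := @g_sh (a :: p) (b :: q) isT isT.
rewrite /= addSn => /(_ Hw); rewrite sum_sh_cons => /eqP.
rewrite addr_eq0 => /eqP ->; rewrite IH; last by rewrite /= addSn -addnS.
by rewrite rev_cons cat_rcons exprS mulN1r mulrNz.
Qed.

(** The case [p = [::]] of [sh_antipode], where the shuffle on the left is the single word [q]. *)
Lemma g_rev x : size x = w -> g x = g (rev x) *~ (-1) ^+ w.-1.
Proof.
case: x => [|a q] Hw; first by rewrite -Hw expr0.
have := @sh_antipode a [::] q; rewrite /= add0n sum_sh0s cats1 -rev_cons.
by rewrite -Hw; apply.
Qed.

End Antipode.

(** * Regularization, and functionals killing shuffle products *)

#[local] Arguments shuffle : simpl never.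

Section Lead.
Variable T : eqType.
Implicit Types (u v x y : seq T) (a c : T).

Definition lead a u := find (predC1 a) u.

Lemma lead_nseq a n : lead a (nseq n a) = n.
Proof. by rewrite /lead; elim: n => //= n ->; rewrite eqxx. Qed.

Lemma lead_nseq_cat a n c x : c != a -> lead a (nseq n a ++ c :: x) = n.
Proof.
by move=> Hc; rewrite /lead; elim: n => /= [|n ->]; rewrite ?Hc ?eqxx.
Qed.

Lemma leadP a u : exists x, u = nseq (lead a u) a ++ x /\ lead a x = 0%N.
Proof.
exists (drop (lead a u) u); split.
  rewrite -{1}(cat_take_drop (lead a u) u); congr (_ ++ _).
  elim: u => //= c u IH; rewrite /lead /=.
  by case: eqVneq => [->|] //=; congr (_ :: _); exact: IH.
elim: u => //= c u IH; rewrite /lead /=.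
by case: eqVneq => //= /negbTE nc; rewrite nc.
Qed.

Lemma lead0_cons a c x : (lead a (c :: x) == 0%N) = (c != a).
Proof. by rewrite /lead /=; case: ifP. Qed.

Lemma lead0_sh a u v x : lead a u = 0%N -> lead a v = 0%N ->
  x \in shuffle u v ->
  lead a x = 0%N.
Proof.
case: u v => [|b u] [|c v] => /eqP + /eqP.
- by rewrite /shuffle /= inE => _ _ /eqP->.
- by rewrite /shuffle /= inE => _ /eqP + /eqP->.
- by rewrite sh_nil inE => /eqP + _ /eqP->.
- rewrite !lead0_cons sh_cons mem_cat => Hb Hc.
  by move=> /orP[] /mapP[y _ ->]; apply/eqP; rewrite lead0_cons.
Qed.

(** The insertions of [a] behind the first letter of [x]. If that letter is not [a], they do not
    lengthen a run [nseq n a] put in front. *)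
Definition ins_tail a x := if x is c :: x' then map (cons c) (shuffle [:: a] x')
  else [::].

Lemma lead_ins_tail a x y n : lead a x = 0%N -> y \in ins_tail a x ->
  lead a (nseq n a ++ y) = n.
Proof.
case: x => //= c x /eqP; rewrite lead0_cons => Hc /mapP[z _ ->].
by rewrite lead_nseq_cat.
Qed.

Lemma mem_ins_tail a x y n : y \in ins_tail a x ->
  nseq n a ++ y \in shuffle [:: a] (nseq n a ++ x).
Proof.
move=> yin; elim: n => [|n IH]; last first.
  by rewrite /= sh_cons mem_cat; apply/orP; right; apply: map_f.
by case: x yin => //= c x yin; rewrite sh_cons mem_cat yin orbT.
Qed.

Lemma nseqS_cat n a x : nseq n a ++ a :: x = nseq n.+1 a ++ x.
Proof. by elim: n => //= n ->. Qed.

Variable V : nmodType.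

(** Insertion into the run gives the same word [n + 1] times. Solved for that word, the formula
    removes one leading [a], which drives the inductions on [lead]. *)
Lemma sum_ins_lead a n x (f : seq T -> V) :
  \sum_(y <- shuffle [:: a] (nseq n a ++ x)) f y =
  f (nseq n.+1 a ++ x) *+ n.+1 + \sum_(y <- ins_tail a x) f (nseq n a ++ y).
Proof.
rewrite sum_ins_nseq mulrSr -addrA; congr (_ + _).
case: x => [|c x]; first by rewrite sum_shs0 nseqS_cat big_nil addr0.
by rewrite sum_sh_cons sum_sh0s nseqS_cat /= big_map.
Qed.

End Lead.
#[local] Arguments ins_tail : simpl never.

Section Extension.
Variables (T : eqType) (R : numFieldType) (a : T).
Implicit Types (u v x y : seq T).

(* Keeps [f] on the words not beginning with [a] and makes the shuffle of the
   letter [a] with any word vanish. *)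
Definition ext (f : seq T -> R) u : R :=
  if drop (lead a u) u is c :: x then
    (-1) ^+ lead a u * \sum_(y <- shuffle (nseq (lead a u) a) x) f (c :: y)
  else (lead a u == 0)%:R.

Variable f : seq T -> R.

Lemma ext_nseq n : ext f (nseq n a) = (n == 0)%:R.
Proof. by rewrite /ext lead_nseq drop_oversize // size_nseq. Qed.

Lemma ext_nseq_cat n c x : c != a -> ext f (nseq n a ++ c :: x) =
  (-1) ^+ n * \sum_(y <- shuffle (nseq n a) x) f (c :: y).
Proof.
by move=> Hc; rewrite /ext lead_nseq_cat // drop_size_cat // size_nseq.
Qed.

Lemma ext_lead0 u : f [::] = 1 -> lead a u = 0%N -> ext f u = f u.
Proof.
move=> f0; case: u => [|c u] /eqP; first by rewrite /ext /= f0.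
rewrite lead0_cons => Hc.
by rewrite -[c :: u]/(nseq 0 a ++ c :: u) ext_nseq_cat // mul1r sum_sh0s.
Qed.

(** By associativity, shuffling [a] and then [nseq n a] into the tail gives [n + 1] times the
    shuffle with [nseq n.+1 a]. This cancels the insertions into the leading run, whose sign is
    opposite. *)
Lemma ext_ins u : \sum_(x <- shuffle [:: a] u) ext f x = 0.
Proof.
have [x [-> lx]] := leadP a u; move: (lead a u) => n {u}.
rewrite sum_ins_lead.
case: x lx => [_|c x /eqP];
  first by rewrite cats0 ext_nseq big_nil mul0rn addr0.
rewrite lead0_cons => Hc; rewrite ext_nseq_cat // /ins_tail big_map.
under eq_bigr do rewrite ext_nseq_cat //.
rewrite -big_distrr /= -sum_shA -[[:: a]]/(nseq 1 a) sum_sh_nseq addn1 binSn.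
by rewrite exprS mulN1r mulNr mulNrn mulrnAr addNr.
Qed.

Lemma ext_lead_ind n x : lead a x = 0%N ->
  ext f (nseq n.+1 a ++ x) *+ n.+1 =
  - \sum_(y <- ins_tail a x) ext f (nseq n a ++ y).
Proof.
by move=> Hx; apply/eqP; rewrite -addr_eq0 -sum_ins_lead ext_ins.
Qed.

Variable D : pred (seq T).
Hypothesis f0 : f [::] = 1.
Hypothesis Da : D [:: a].
Hypothesis D_tail : forall u, D (a :: u) -> D u.
Hypothesis D_sh : forall u v x, D u -> D v -> x \in shuffle u v -> D x.
Hypothesis f_mul : forall u v, D u -> D v -> lead a u = 0%N -> lead a v = 0%N ->
  f u * f v = \sum_(x <- shuffle u v) f x.

(** Multiplied by [m + 1], a factor with [m + 1] leading letters [a] becomes minus a sum over words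
    with fewer ([ext_lead_ind]), where induction applies. By associativity the defect is an
    insertion of [a] into the shuffle of the remaining words, which [ext_ins] kills. [D] is [h1] in
    the first use and all words in the second. *)
Lemma ext_mul u v : D u -> D v ->
  ext f u * ext f v = \sum_(x <- shuffle u v) ext f x.
Proof.
have [n] := ubnP (lead a u + lead a v)%N; elim: n u v => // n IH u v.
have key s t : (0 < lead a s)%N -> (lead a s + lead a t < n.+1)%N -> D s ->
  D t ->
    ext f s * ext f t = \sum_(x <- shuffle s t) ext f x.
  have [x [Es lx]] := leadP a s; move: (lead a s) Es => [//|m] -> _ Hn Ds Dt.
  have m0 : m.+1%:R != 0 :> R by rewrite pnatr_eq0.
  apply: (mulfI m0); rewrite mulrA !mulr_natl ext_lead_ind // mulNr.
  apply/eqP; rewrite eq_sym -addr_eq0 big_distrl /=.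
  have Dm : D (nseq m a ++ x) by apply: D_tail.
  have Dy y : y \in ins_tail a x -> D (nseq m a ++ y).
    by move=> yin; apply: (D_sh Da Dm); apply: mem_ins_tail.
  rewrite [X in _ + X]big_seq; under [X in _ + X]eq_bigr => y yin.
    rewrite IH ?Dy // ?(lead_ins_tail _ lx) //; over.
  rewrite -[X in _ + X]big_seq
    -(sum_ins_lead a m x (fun y => \sum_(z <- shuffle y t) ext f z)).
  by rewrite sum_shA big1 // => z _; apply: ext_ins.
move=> Hn Du Dv; case lu : (lead a u) => [|m]; last by apply: key;
  rewrite ?lu // -lu.
case lv : (lead a v) => [|m].
  rewrite !ext_lead0 // f_mul //.
  rewrite big_seq [RHS]big_seq; apply: eq_bigr => y yin.
  by rewrite ext_lead0 // (lead0_sh _ _ yin).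
by rewrite mulrC sum_shC; apply: key; rewrite ?lv // -lv addnC.
Qed.

End Extension.

(** * Vanishing criteria for functionals that kill insertions *)

Section Vanishing.
Variables (T : eqType) (V : zmodType).
Hypothesis V_torsion_free : forall (v : V) n, v *+ n.+1 = 0 -> v = 0.
Implicit Types (u v x y : seq T) (g : seq T -> V).

(** The recursion of [ext] again, with values in [V]: a leading [a] is removed at the price of a
    factor [m + 1], which torsion-freeness cancels. *)
Lemma ins_vanish a (D : pred (seq T)) g w :
  D [:: a] -> (forall u, D (a :: u) -> D u) ->
  (forall u v x, D u -> D v -> x \in shuffle u v -> D x) ->
  (forall u, (size u).+1 = w -> \sum_(x <- shuffle [:: a] u) g x = 0) ->
  (forall u, size u = w -> D u -> lead a u = 0%N -> g u = 0) ->
  forall u, size u = w -> D u -> g u = 0.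
Proof.
move=> Da D_tail D_sh g_ins g0 u.
have [n] := ubnP (lead a u); elim: n u => // n IH u.
have [x [Eu lx]] := leadP a u; move: (lead a u) Eu => [|m] -> Hn Hs Du.
  exact: g0.
apply: (V_torsion_free (n := m)); have Dm : D (nseq m a ++ x) by apply: D_tail.
have := g_ins (nseq m a ++ x); rewrite sum_ins_lead => /(_ Hs) /eqP.
rewrite addr_eq0 => /eqP->; rewrite big_seq big1 ?oppr0 // => y yin.
have yin' := mem_ins_tail m yin.
apply: IH; first by rewrite (lead_ins_tail _ lx).
  by rewrite (size_sh yin').
exact: D_sh yin'.
Qed.

Lemma sum_ins_take a v g : \sum_(y <- shuffle [:: a] v) g y =
  \sum_(i < (size v).+1) g (take i v ++ a :: drop i v).
Proof.
elim: v g => [|b v IH] g; first by rewrite sum_shs0 big_ord1.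
by rewrite sum_sh_cons sum_sh0s IH [RHS]big_ord_recl.
Qed.

(* Inserting [a] in all positions of [v] and rotating [a] back to the front
   yields [a v] plus the sum over all rotations of [v] behind [a]. *)
Lemma cyclic_vanish g w : (1 < w)%N ->
  (forall u, (size u).+1 = w -> forall a, \sum_(x <- shuffle [:: a] u) g x =
    0) ->
  (forall a u, (size u).+1 = w -> g (a :: u) = g (rcons u a)) ->
  forall x, size x = w -> g x = 0.
Proof.
move=> w1 g_ins g_cyc [|a v] Hx; first by rewrite -Hx in w1.
have g_cat s t : size (s ++ t) = w -> g (s ++ t) = g (t ++ s).
  elim: s t => [|b s IH] t Hs; first by rewrite cats0.
  rewrite cat_cons g_cyc // -cats1 -catA IH; first by rewrite -catA.
  by rewrite -Hs !size_cat /= addn1 addnS.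
pose N u := \sum_(i < size u) g (a :: rot i u).
have gN u : size u = size v -> g (a :: u) = - N u.
  move=> Hu; apply/eqP; rewrite -addr_eq0 addrC.
  rewrite -[X in g (a :: X)]rot_size.
  have -> : N u + g (a :: rot (size u) u) =
    \sum_(i < (size u).+1) g (a :: rot i u).
    by rewrite big_ord_recr.
  have Hu' : (size u).+1 = w by rewrite Hu.
  apply/eqP; apply: etrans (g_ins _ Hu' a); rewrite sum_ins_take.
  apply: eq_bigr => i _; rewrite /rot -cat_cons g_cat //.
  by rewrite size_cat /= addSn addnC -size_cat cat_take_drop Hu.
have N1 u : N (rot 1 u) = N u.
  rewrite /N size_rot; under eq_bigr do rewrite rot_rot.
  case: u => [|b u]; first by rewrite !big_ord0.
  rewrite [RHS]big_ord_recl big_ord_recr /= addrC; congr (g (_ :: _) + _).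
    by rewrite -rotS // -[(size u).+1]/(size (b :: u)) rot_size rot0.
  by apply: eq_bigr => i _; rewrite /bump add1n [in RHS]rotS //= ltnW // ltnS.
have Nrot j : (j <= size v)%N -> N (rot j v) = N v.
  elim: j => [|j IH] lej; first by rewrite rot0.
  by rewrite rotS // N1 IH // ltnW.
(* By [gN] and [Nrot] all the summands [g (a :: rot i v)] have the common value [- N v]. *)
have NE : N v = g (a :: v) *+ size v.
  rewrite /N -[in RHS](card_ord (size v)) -sumr_const; apply: eq_bigr => i _.
  by rewrite !gN ?size_rot // Nrot // ltnW.
apply: (V_torsion_free (n := size v)); apply/eqP.
by rewrite mulrS addrC -NE addr_eq0 gN // opprK.
Qed.

End Vanishing.

(** * Duality and rotation for words in two letters *)

Section Symmetry.
Variable V : zmodType.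
Hypothesis V_torsion_free : forall (v : V) n, v *+ n.+1 = 0 -> v = 0.
Implicit Types (u v x y : seq bool).

(* Hoffman's spaces: the head of a word is its outermost letter and [true] is
   the form dz/(1-z), so [h1] are the words of indices and [h0] those of
   admissible indices. *)
Definition h1 x := last true x.
Definition h0 x := ~~ head false x && h1 x.

Lemma h1_tail b u : h1 (b :: u) -> h1 u.
Proof. by case: u. Qed.

Lemma h1_sh u v x : h1 u -> h1 v -> x \in shuffle u v -> h1 x.
Proof. exact: last_sh. Qed.

Lemma h0E x : h0 x = (lead true x == 0%N) && h1 x.
Proof. by case: x => // -[] x; rewrite /h0 ?lead0_cons. Qed.

(** Two rounds of [ins_vanish]: leading letters [true] are removed inside [h1], then trailing
    letters [false], which are leading ones of the reversed word. *)
Lemma word_vanish (g : seq bool -> V) w : (0 < w)%N ->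
  (forall a u, (size u).+1 = w -> \sum_(x <- shuffle [:: a] u) g x = 0) ->
  (forall x, size x = w -> h0 x -> g x = 0) ->
  forall x, size x = w -> g x = 0.
Proof.
move=> w0 g_ins g0.
have g1 x : size x = w -> h1 x -> g x = 0.
  apply: (ins_vanish V_torsion_free (a := true) (D := h1)) => //.
  - exact: h1_sh.
  - exact: g_ins.
  - by move=> u Hu Du lu; apply: g0 => //; rewrite h0E lu.
move=> x Hx; rewrite -[x]revK.
apply: (ins_vanish V_torsion_free (a := false) (D := predT) (g := g \o rev)
  (w := w)) => //=.
- by move=> u Hu; rewrite -sum_sh_rev; apply: g_ins; rewrite size_rev.
- move=> u Hu _ lu; apply: g1; rewrite ?size_rev // /h1.
  case: u Hu lu => [|b u] Hu /eqP lu0; first by rewrite -Hu in w0.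
  by move: lu0; rewrite lead0_cons rev_cons last_rcons; case: (b).
- by rewrite size_rev.
Qed.

Variables (g : seq bool -> V) (w : nat).
Hypothesis w1 : (1 < w)%N.
Hypothesis g_sh : forall u v, u != [::] -> v != [::] ->
  (size u + size v = w)%N -> \sum_(x <- shuffle u v) g x = 0.
Hypothesis g_dual : forall x, size x = w -> h0 x -> g (rev (map negb x)) = g x.
Hypothesis g_F : forall u, (size u).+1 = w ->
  g (rcons (rev u) true) = g (rcons u true) *~ (-1) ^+ w.-1.

Let g_ins a u : (size u).+1 = w -> \sum_(x <- shuffle [:: a] u) g x = 0.
Proof.
move=> Hu; apply: g_sh => //.
by case: u Hu => // E; move: w1; rewrite -E.
Qed.

(** The difference between [g] and its dual kills insertions and vanishes on [h0], so [word_vanish]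
    extends duality to all words of length [w]; the reversal is then undone by [g_rev]. *)
Lemma g_negb x : size x = w -> g (map negb x) = g x *~ (-1) ^+ w.-1.
Proof.
have sign2 (v : V) : v *~ (-1) ^+ w.-1 *~ (-1) ^+ w.-1 = v.
  by rewrite -mulrzA -exprMn mulrNN mulr1 expr1n.
have dual y : size y = w -> g (rev (map negb y)) = g y.
  move=> Hy; apply/eqP; rewrite -subr_eq0; apply/eqP; move: y Hy.
  apply: (word_vanish (g := fun y => g (rev (map negb y)) - g y)).
  - exact: ltnW.
  - move=> a u Hu; rewrite sumrB (g_ins _ Hu) subr0.
    rewrite -(sum_sh_map negb _ _ (g \o rev)) -sum_sh_rev.
    apply: g_ins; first by rewrite size_rev size_map.
  - by move=> y Hy h0y; rewrite g_dual // subrr.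
move=> Hx; rewrite (g_rev g_sh Hx) sign2 -dual ?size_map //.
by rewrite (mapK negbK).
Qed.

(* By [g_F] and the antipode [g] is invariant under rotating a letter [true]
   from front to back, and duality transports this to [false]. *)
Theorem symmetric_vanish x : size x = w -> g x = 0.
Proof.
apply: (cyclic_vanish V_torsion_free w1) => [u Hu a|a u Hu]; first exact: g_ins.
have cyc1 v : (size v).+1 = w -> g (true :: v) = g (rcons v true).
  move=> Hv; rewrite (g_rev g_sh) // rev_cons g_F // -mulrzA.
  by rewrite -exprMn mulrNN mulr1 expr1n.
case: a; first exact: cyc1.
have Hn : (size (map negb u)).+1 = w by rewrite size_map.
have := cyc1 _ Hn.
rewrite -[X in g X = _]/(map negb (false :: u)) -[true]/(negb false) -map_rcons.
rewrite !g_negb ?size_rcons // => E.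
rewrite -[LHS]mulr1z -[RHS]mulr1z -(expr1n _ w.-1) -[1]mulr1 -mulrNN exprMn.
by rewrite !mulrzA E.
Qed.

End Symmetry.

(** * Truncated sums and their growth *)

Section Convolution.
Variable R : comPzRingType.
Implicit Types a b : nat -> R.

(** On generating series [psum] multiplies by z/(1-z), the index [m] itself being left out, and
    [conv] is the product. Multiplication by [m%:R] is the operator z d/dz, for which [conv_theta]
    is Leibniz's rule. *)
Definition psum a m := \sum_(j < m) a j.
Definition conv a b m := \sum_(i < m.+1) a i * b (m - i)%N.

Lemma psumS a m : psum a m.+1 = psum a m + a m.
Proof. by rewrite /psum big_ord_recr. Qed.

Lemma psum0 a : psum a 0 = 0.
Proof. by rewrite /psum big_ord0. Qed.

Lemma convC a b m : conv a b m = conv b a m.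
Proof.
rewrite /conv (reindex_inj rev_ord_inj) /=; apply: eq_bigr => i _.
by rewrite subSS subKn 1?mulrC // -ltnS.
Qed.

Lemma conv_psum a b m : conv (psum a) b m = psum (conv a b) m.
Proof.
elim: m => [|m IH]; first by rewrite /conv big_ord1 !psum0 mul0r.
rewrite psumS -IH /conv [LHS]big_ord_recl psum0 mul0r add0r -big_split /=.
by apply: eq_bigr => i _; rewrite /bump add1n psumS subSS mulrDl.
Qed.

Lemma conv_theta a b m : m%:R * conv a b m =
  conv (fun i => i%:R * a i) b m + conv a (fun i => i%:R * b i) m.
Proof.
rewrite /conv big_distrr -big_split /=; apply: eq_bigr => i _.
have {1}-> : m = (i + (m - i))%N by rewrite subnKC // -ltnS.
by rewrite natrD; ring.
Qed.

Lemma eq_conv a a' b b' m : a =1 a' -> b =1 b' -> conv a b m = conv a' b' m.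
Proof. by move=> Ea Eb; apply: eq_bigr => i _; rewrite Ea Eb. Qed.

End Convolution.

(** * Polylogarithm coefficients and logarithmic bounds *)

Section Coefficients.
Variable R : realFieldType.
Implicit Types (u v x : seq bool).

(* [mc u m] is the coefficient of [z ^ m] in the multiple polylogarithm of the
   word whose letters, read from the outermost one, are [u]: [false] stands for
   the form dz/z and [true] for dz/(1-z). *)
Fixpoint mc u (m : nat) : R :=
  if u is b :: u' then (if b then psum (mc u') m else mc u' m) / m%:R
  else (m == 0%N)%:R.

Definition ms u := psum (mc u).

Lemma mc_ge0 u m : 0 <= mc u m.
Proof.
elim: u m => [|[] u IH] m /=; first by case: eqP.
  by rewrite divr_ge0 // sumr_ge0.
by rewrite divr_ge0.
Qed.

Lemma mc_cons0 b u : mc (b :: u) 0 = 0.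
Proof. by rewrite /= invr0 mulr0. Qed.

Lemma mc_theta b u m : h1 (b :: u) ->
  m%:R * mc (b :: u) m = if b then psum (mc u) m else mc u m.
Proof.
case: m => [|m] Hu.
  rewrite mul0r; case: b Hu => [_|]; first by rewrite psum0.
  by case: u => // c u _; rewrite mc_cons0.
by rewrite /= mulrC divfK // pnatr_eq0.
Qed.

(** Both sides have the same image under z d/dz, by Leibniz's rule and induction, hence the same
    coefficients for [m > 0]; constant terms of nonempty words vanish. *)
Lemma mc_conv u v m : h1 u -> h1 v ->
  conv (mc u) (mc v) m = \sum_(x <- shuffle u v) mc x m.
Proof.
move: u v m; apply: sh_ind => [v m _ _|u m _ _|a u b v IH1 IH2 m Hu Hv].
- rewrite sum_sh0s /conv big_ord_recl /= mul1r subn0 big1 ?addr0 // => i _.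
  by rewrite mul0r.
- rewrite sum_shs0 convC /conv big_ord_recl /= mul1r subn0 big1 ?addr0 // => i
  _.
  by rewrite mul0r.
- case: m => [|m].
    rewrite /conv big_ord1 mc_cons0 mul0r big_seq big1 // => x /size_sh.
    by case: x => // c x _; rewrite mc_cons0.
  have m0 : m.+1%:R != 0 :> R by rewrite pnatr_eq0.
  apply: (mulfI m0); rewrite conv_theta sum_sh_cons mulrDr.
  congr (_ + _).
    rewrite (eq_conv (a' := if a then psum (mc u) else mc u)
      (b' := mc (b :: v))) //;
      last by move=> i; rewrite mc_theta //; case: (a).
    rewrite big_distrr /= big_seq.
    under eq_bigr => x xin.
      rewrite mulrC divfK //; over.
    rewrite -big_seq; case: (a); rewrite ?conv_psum.
      rewrite /psum exchange_big /=; apply: eq_bigr => i _.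
      by rewrite IH1 // (h1_tail Hu).
    by rewrite IH1 // (h1_tail Hu).
  rewrite (eq_conv (a' := mc (a :: u)) (b' := if b then psum (mc v) else mc v))
    //;
    last by move=> i; rewrite mc_theta //; case: (b).
  rewrite big_distrr /= big_seq.
  under eq_bigr => x xin.
    rewrite mulrC divfK //; over.
  rewrite -big_seq convC; case: (b); rewrite ?conv_psum.
    rewrite /psum exchange_big /=; apply: eq_bigr => i _.
    by rewrite convC IH2 // (h1_tail Hv).
  by rewrite convC IH2 // (h1_tail Hv).
Qed.

(** Shuffling convolves coefficients, so its truncation runs over the triangle [i + j < M] and not
    over the square that gives [ms u M * ms v M]. *)
Lemma ms_sh u v M : h1 u -> h1 v ->
  \sum_(x <- shuffle u v) ms x M = \sum_(i < M.+1) mc v i * ms u (M - i).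
Proof.
move=> Hu Hv; rewrite -[RHS]/(conv (mc v) (ms u) M) convC conv_psum.
rewrite /ms /psum exchange_big /=; apply: eq_bigr => i _.
by rewrite mc_conv.
Qed.

(** Harmonic numbers in place of the logarithm; the initial 1 makes powers increase with the
    exponent. *)
Definition lg m : R := 1 + \sum_(j < m) j.+1%:R^-1.

Lemma lgS m : lg m.+1 = lg m + m.+1%:R^-1.
Proof. by rewrite /lg big_ord_recr /= addrA. Qed.

Lemma lg_ge1 m : 1 <= lg m.
Proof. by rewrite lerDl sumr_ge0 // => i _; rewrite invr_ge0. Qed.

Lemma lg_ge0 m : 0 <= lg m.
Proof. exact: le_trans (lg_ge1 m). Qed.

Lemma lg_gt0 m : 0 < lg m.
Proof. exact: lt_le_trans (lg_ge1 m). Qed.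

Lemma lg_homo m n : (m <= n)%N -> lg m <= lg n.
Proof.
move=> /subnKC <-; elim: (n - m)%N => [|k IH]; first by rewrite addn0.
by rewrite addnS lgS (le_trans IH) // lerDl invr_ge0.
Qed.

Lemma lgX_homo c m n : (m <= n)%N -> lg m ^+ c <= lg n ^+ c.
Proof. by move=> le; rewrite lerXn2r ?nnegrE ?lg_ge0 ?lg_homo. Qed.

Lemma lgX_le c d m : (c <= d)%N -> lg m ^+ c <= lg m ^+ d.
Proof. by move=> le; rewrite ler_weXn2l // lg_ge1. Qed.

Lemma ms_ge0 u m : 0 <= ms u m.
Proof. by apply: sumr_ge0 => i _; apply: mc_ge0. Qed.

Lemma ms_homo u m n : (m <= n)%N -> ms u m <= ms u n.
Proof.
move=> /subnKC <-; elim: (n - m)%N => [|k IH]; first by rewrite addn0.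
by rewrite addnS /ms psumS (le_trans IH) // lerDl mc_ge0.
Qed.

Lemma ms_le_mc u c : (forall m, mc u m <= lg m ^+ c / m%:R) ->
  forall m, ms u m <= lg m ^+ c.+1.
Proof.
move=> H m; apply: (@le_trans _ _ (lg m ^+ c * (\sum_(j < m) j%:R^-1))).
  rewrite big_distrr; apply: ler_sum => i _ /=; apply: le_trans (H i) _.
  by rewrite ler_wpM2r ?invr_ge0 // lgX_homo // ltnW.
rewrite exprSr ler_wpM2l ?exprn_ge0 ?lg_ge0 //.
case: m => [|m]; first by rewrite big_ord0 lg_ge0.
rewrite big_ord_recl invr0 add0r; apply: le_trans (lg_homo (leqnSn m)).
by rewrite lerDr.
Qed.

Lemma mc_le b u m : mc (b :: u) m <= lg m ^+ size u / m%:R.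
Proof.
elim: u b m => [|b' u IH] b m.
  rewrite expr0 /= ler_wpM2r ?invr_ge0 //.
  case: b; last by case: eqP.
  case: m => [|m]; rewrite ?psum0 // /psum big_ord_recl /= big1 ?addr0 //.
rewrite [mc _ _]/= ler_wpM2r ?invr_ge0 //; case: b; last first.
  apply: le_trans (IH b' m) _; apply: le_trans (lgX_le m (leqnSn _)).
  rewrite ler_piMr ?exprn_ge0 ?lg_ge0 //.
  by case: m => [|m]; rewrite ?invr0 ?ler01 // invf_le1 ?ler1n.
exact: (@ms_le_mc (b' :: u) (size u) (IH b')).
Qed.

Lemma ms_le u m : ms u m <= lg m ^+ size u.
Proof.
case: u => [|b u]; last by apply: ms_le_mc; apply: mc_le.
case: m => [|m]; first by rewrite /ms psum0 ler01.
by rewrite /ms /psum big_ord_recl big1 ?addr0.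
Qed.

Lemma mc_false_le u m : u != [::] ->
  mc (false :: u) m <= lg m ^+ size u / m%:R ^+ 2.
Proof.
case: u => // b u _; rewrite [mc _ _]/= expr2 invfM mulrA ler_wpM2r ?invr_ge0
  //.
apply: le_trans (mc_le b u m) _; rewrite ler_wpM2r ?invr_ge0 // lgX_le //.
Qed.

Lemma exprB_le (x y : R) c : 0 <= y -> y <= x ->
  x ^+ c - y ^+ c <= (x - y) * (c%:R * x ^+ c.-1).
Proof.
move=> y0 yx; have x0 := le_trans y0 yx.
elim: c => [|c IH]; first by rewrite !expr0 subrr mul0r mulr0.
have -> : x ^+ c.+1 - y ^+ c.+1 = x * (x ^+ c - y ^+ c) + (x - y) * y ^+ c.
  by rewrite !exprS; ring.
apply: (@le_trans _ _ (x * ((x - y) * (c%:R * x ^+ c.-1)) + (x - y) * x ^+ c)).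
  apply: lerD; first by rewrite ler_wpM2l.
  by rewrite ler_wpM2l ?subr_ge0 // lerXn2r.
rewrite le_eqVlt; apply/orP; left; apply/eqP.
by case: c {IH} => [|c] /=; rewrite -?natr1 ?exprS; ring.
Qed.

(* Abel summation, by which the exponent [c] drops by one. *)
Lemma lg_abel c M :
  \sum_(j < M) lg j.+1 ^+ c * (j.+1%:R^-1 - j.+2%:R^-1) + lg M ^+ c / M.+1%:R <=
  1 + c%:R * \sum_(j < M) lg j.+1 ^+ c.-1 / j.+1%:R ^+ 2.
Proof.
elim: M => [|M IH]; first by rewrite !big_ord0 mulr0 add0r /lg big_ord0 !addr0
  expr1n divr1.
rewrite !big_ord_recr /=.
have := @exprB_le (lg M.+1) (lg M) c (lg_ge0 M) (lg_homo (leqnSn M)).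
rewrite {2}lgS [lg M + _ - _]addrAC subrr add0r => H.
have {}H : (lg M.+1 ^+ c - lg M ^+ c) / M.+1%:R <=
    c%:R * (lg M.+1 ^+ c.-1 / M.+1%:R ^+ 2).
  apply: le_trans (_ : _ <= M.+1%:R^-1 * (c%:R * lg M.+1 ^+ c.-1) / M.+1%:R) _.
    by rewrite ler_wpM2r ?invr_ge0.
  by rewrite expr2 invfM le_eqVlt; apply/orP; left; apply/eqP; ring.
move: IH H; rewrite mulrBl !mulrDr mulrN.
move: (\sum_(i < M) _) (c%:R * _) (c%:R * _) (_ / M.+1%:R) (_ / M.+1%:R)
  (_ / M.+2%:R) => A B C D E F.
lra.
Qed.

(** One step of the induction on the exponent: the hypothesis bounds the right side of [lg_abel].
    The 2 comes from [1/n^2 <= 2 (1/n - 1/(n+1))]. *)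
Lemma lg_bound_step c K :
  (forall M, c%:R * \sum_(j < M) lg j.+1 ^+ c.-1 / j.+1%:R ^+ 2 <= K) ->
  forall M, \sum_(j < M) lg j.+1 ^+ c / j.+1%:R ^+ 2 <= 2 * (1 + K) /\
    lg M ^+ c / M.+1%:R <= 1 + K.
Proof.
move=> HK M; have half j : (j.+1%:R ^+ 2)^-1 <=
  2 * (j.+1%:R^-1 - j.+2%:R^-1) :> R.
  have j1 : 1 <= j.+1%:R :> R by rewrite ler1n.
  rewrite -[j.+2%:R]natr1; move: (j.+1%:R) j1 => x x1.
  have x0 : 0 < x by lra.
  have -> : 2 * (x^-1 - (x + 1)^-1) = (x ^+ 2)^-1 * (2 * x / (x + 1)).
    by field; rewrite !gt_eqF //; lra.
  rewrite ler_peMr ?invr_ge0 ?exprn_ge0 ?(ltW x0) // ler_pdivlMr; lra.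
  have := lg_abel c M.
have := HK M.
have : \sum_(j < M) lg j.+1 ^+ c / j.+1%:R ^+ 2 <= 2 *
    \sum_(j < M) lg j.+1 ^+ c * (j.+1%:R^-1 - j.+2%:R^-1).
  rewrite big_distrr; apply: ler_sum => j _ /=.
  by rewrite mulrCA ler_wpM2l ?exprn_ge0 ?lg_ge0.
have : 0 <= \sum_(j < M) lg j.+1 ^+ c / j.+1%:R ^+ 2.
  by apply: sumr_ge0 => j _; rewrite divr_ge0 ?exprn_ge0 ?lg_ge0.
have : 0 <= lg M ^+ c / M.+1%:R by rewrite divr_ge0 ?exprn_ge0 ?lg_ge0.
move: (\sum_(j < M) _) (\sum_(j < M) _) => A B;
  move: (_ * \sum_(j < M) _) (lg M ^+ c / _) => C D.
by split; lra.
Qed.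

Lemma lg_sum_bounded c : exists K : R, forall M,
  \sum_(j < M) lg j.+1 ^+ c / j.+1%:R ^+ 2 <= K.
Proof.
elim: c => [|c [K HK]].
  have H M : 0%:R * \sum_(j < M) lg j.+1 ^+ 0.-1 / j.+1%:R ^+ 2 <=
    0 by rewrite mul0r.
  by exists (2 * (1 + 0)) => M; have [] := lg_bound_step H M.
exists (2 * (1 + c.+1%:R * K)) => M.
by apply: (proj1 (lg_bound_step _ M)) => N; rewrite ler_wpM2l.
Qed.

Lemma lg_bounded c : exists K : R, forall M, lg M ^+ c / M.+1%:R <= K.
Proof.
have [K HK] := lg_sum_bounded c.-1; exists (1 + c%:R * K) => M.
by apply: (proj2 (lg_bound_step _ M)) => N; rewrite ler_wpM2l.
Qed.

(** Smallness against every power of [lg] survives multiplication by truncated sums, which [ms_le]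
    bounds by such powers. *)
Definition negligible (e : nat -> R) :=
  forall c, exists K : R, forall M, `|e M| * lg M ^+ c <= K.

Lemma eq_negligible e e' : e =1 e' -> negligible e -> negligible e'.
Proof.
by move=> E N c; have [K HK] := N c; exists K => M; rewrite -E.
Qed.

Lemma negligible0 : negligible (fun=> 0).
Proof. by move=> c; exists 0 => M; rewrite normr0 mul0r. Qed.

Lemma negligibleD e e' : negligible e -> negligible e' ->
  negligible (fun M => e M + e' M).
Proof.
move=> N N' c; have [K HK] := N c; have [K' HK'] := N' c; exists (K + K') => M.
apply: (@le_trans _ _ ((`|e M| + `|e' M|) * lg M ^+ c)).
  by rewrite ler_wpM2r ?exprn_ge0 ?lg_ge0 ?ler_normD.
by rewrite mulrDl lerD.
Qed.

Lemma negligible_sum (I : eqType) (r : seq I) (e : I -> nat -> R) :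
  (forall i, i \in r -> negligible (e i)) ->
  negligible (fun M => \sum_(i <- r) e i M).
Proof.
elim: r => [|i r IH] H.
  by apply: eq_negligible negligible0 => M; rewrite big_nil.
apply: (@eq_negligible (fun M => e i M + \sum_(j <- r) e j M)).
  by move=> M; rewrite big_cons.
apply: negligibleD; first by apply: H; rewrite mem_head.
by apply: IH => j jr; apply: H; rewrite inE jr orbT.
Qed.

Lemma negligibleM e (a : nat -> R) (C : R) d : negligible e ->
  (forall M, `|a M| <= C * lg M ^+ d) -> negligible (fun M => e M * a M).
Proof.
move=> N Ha c; have [K HK] := N (d + c)%N; exists (C * K) => M.
have C0 : 0 <= C.
  have := le_trans (normr_ge0 _) (Ha M).
  by rewrite pmulr_lge0 // exprn_gt0 // lg_gt0.
apply: le_trans (_ : _ <= C * (`|e M| * lg M ^+ (d + c))) _.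
  rewrite normrM exprD [leRHS]mulrCA -!mulrA ler_wpM2l // mulrA.
  by rewrite ler_wpM2r ?exprn_ge0 ?lg_ge0.
by rewrite ler_wpM2l.
Qed.

Lemma negligibleZ e (C : R) : negligible e -> negligible (fun M => e M * C).
Proof.
move=> N; apply: (@negligibleM _ _ `|C| 0) => // M.
by rewrite expr0 mulr1.
Qed.

Lemma negligible_le e (f : nat -> R) : negligible f ->
  (forall M, `|e M| <= f M) -> negligible e.
Proof.
move=> N H c; have [K HK] := N c; exists K => M; apply: le_trans (HK M).
rewrite ler_wpM2r ?exprn_ge0 ?lg_ge0 //; apply: le_trans (H M) _.
exact: ler_norm.
Qed.

Lemma negligible_lg d : negligible (fun M => lg M ^+ d / M.+1%:R).
Proof.
move=> c; have [K HK] := lg_bounded (d + c); exists K => M.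
apply: le_trans (HK M); rewrite ger0_norm ?divr_ge0 ?exprn_ge0 ?lg_ge0 //.
by rewrite mulrAC exprD.
Qed.

(* Up to logarithms [ms u M - ms u (M - i)] is of order [i / (M - i + 1)] and
   [mc v i] is of order [1 / i ^ 2]. *)
Lemma negligible_conv u v : h1 u -> u != [::] -> h0 v -> v != [::] ->
  negligible (fun M => \sum_(i < M.+1) mc v i * (ms u M - ms u (M - i))).
Proof.
case: u => // b u _ _; case: v => // -[] // v h0v _.
have v0 : v != [::] by case: v h0v.
pose d := (size v + size u)%N.
apply: (negligible_le (negligibleZ (4 : R) (negligible_lg d.+1))) => M.
rewrite ger0_norm; last first.
  apply: sumr_ge0 => i _; rewrite mulr_ge0 ?mc_ge0 // subr_ge0 ms_homo //.
  exact: leq_subr.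
have inner i : (0 < i <= M)%N -> ms (b :: u) M - ms (b :: u) (M - i) <=
    lg M ^+ size u * (2 * i%:R / (M - i).+1%:R).
  move=> /andP[i0 leM].
  have -> : ms (b :: u) M - ms (b :: u) (M - i) =
      \sum_(j < i) mc (b :: u) (M - i + j).
    rewrite -{1}(subnK leM) /ms; move: (M - i)%N => p; elim: (i) => [|k IH].
      by rewrite addn0 subrr big_ord0.
    by rewrite addnS psumS big_ord_recr /= -IH addrAC.
  (* The index [k = M - i + j] is at least [M - i]; when positive it satisfies [M - i + 1 <= 2 k],
     which accounts for the 2. *)
  apply: (@le_trans _ _ (\sum_(j < i) lg M ^+ size u * (2 / (M - i).+1%:R))).
    apply: ler_sum => j _; set k := (M - i + j)%N.
    have lek : (k <= M)%N by rewrite /k -[leqRHS](subnK leM) leq_add2l ltnW.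
    case k0 : k => [|k'].
      by rewrite mc_cons0 mulr_ge0 ?divr_ge0 ?exprn_ge0 ?lg_ge0.
    apply: le_trans (mc_le b u k'.+1) _; apply: ler_pM => //.
    - by rewrite exprn_ge0 ?lg_ge0.
    - by rewrite lgX_homo // -k0.
    - rewrite ler_pdivlMr ?ltr0n // mulrC ler_pdivrMr ?ltr0n // -natrM ler_nat.
      rewrite -k0 mul2n -addnn {2}k0 addnS -addSn.
      by apply: leq_trans (leq_addr _ _); rewrite ltnS leq_addr.
  rewrite sumr_const card_ord -mulr_natr le_eqVlt; apply/orP; left; apply/eqP.
  by ring.
rewrite big_ord_recl mc_cons0 mul0r add0r.
(* Partial fractions: as [j + 1] and [M - j] add up to [M + 1], the product of their reciprocals
   splits into two harmonic terms over [M + 1]. *)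
apply: (@le_trans _ _ (\sum_(j < M) 2 * lg M ^+ d / M.+1%:R *
    (j.+1%:R^-1 + (M - j)%:R^-1))).
  apply: ler_sum => j _; rewrite lift0.
  have jM : (0 < j.+1 <= M)%N by rewrite /= ltn_ord.
  apply: (@le_trans _ _ ((lg M ^+ size v / j.+1%:R ^+ 2) *
     (lg M ^+ size u * (2 * j.+1%:R / (M - j.+1).+1%:R)))).
    apply: ler_pM; rewrite ?mc_ge0 ?subr_ge0 ?ms_homo ?leq_subr ?inner //.
    apply: le_trans (mc_false_le _ v0) _.
    by rewrite ler_wpM2r ?invr_ge0 ?exprn_ge0 // lgX_homo.
  rewrite subnSK // /d exprD le_eqVlt; apply/orP; left; apply/eqP.
  have -> : M.+1%:R = j.+1%:R + (M - j)%:R :> R.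
    by rewrite -natrD addSn subnKC // ltnW.
  have : 0 < (M - j)%:R :> R by rewrite ltr0n subn_gt0.
  have : 0 < j.+1%:R :> R by rewrite ltr0n.
  move: (j.+1%:R) ((M - j)%:R) => x y x0 y0.
  by field; rewrite !gt_eqF //; lra.
rewrite -big_distrr /=.
have H1 : \sum_(j < M) j.+1%:R^-1 <= lg M by rewrite lerDr.
have -> : \sum_(j < M) (j.+1%:R^-1 + (M - j)%:R^-1) =
    2 * \sum_(j < M) j.+1%:R^-1 :> R.
  rewrite big_split /= mulr2n mulrDl mul1r; congr (_ + _).
  rewrite (reindex_inj rev_ord_inj) /=; apply: eq_bigr => j _.
  by rewrite subKn.
rewrite exprSr.
have -> : lg M ^+ d * lg M / M.+1%:R * 4 =
  2 * lg M ^+ d / M.+1%:R * (2 * lg M) by ring.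
by rewrite !ler_wpM2l // divr_ge0 // mulr_ge0 // exprn_ge0 // lg_ge0.
Qed.

End Coefficients.

(** * Shuffle-regularized multiple zeta values *)

Section Zeta.
Variable R : realType.
Implicit Types (u v x y z : seq bool).
Local Notation mc := (@mc R).
Local Notation ms := (@ms R).
Local Notation lg := (@lg R).

Lemma cvgn_sum (I : eqType) (r : seq I) (f : I -> nat -> R) (l : I -> R) :
  (forall i, i \in r -> f i @ \oo --> l i) ->
  (fun M => \sum_(i <- r) f i M) @ \oo --> \sum_(i <- r) l i.
Proof.
elim: r => [|i r IH] H.
  by rewrite big_nil; under eq_fun do rewrite big_nil; apply: cvg_cst.
rewrite big_cons; under eq_fun do rewrite big_cons.
apply: cvgD; first by apply: H; rewrite mem_head.
by apply: IH => j jr; apply: H; rewrite inE jr orbT.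
Qed.

Lemma lg_unbounded (A : R) : exists M, A < lg M.
Proof.
apply: contrapT => H.
have ub M : lg M <= A by rewrite leNgt; apply/negP => lt; apply: H; exists M.
apply: (@dvg_harmonic R); apply: nondecreasing_is_cvgn.
  by apply/nondecreasing_seqP => n; rewrite seriesSr lerDl invr_ge0.
exists A => _ [n _ <-]; apply: le_trans (ub n).
by rewrite /lg /series /= big_mkord lerDr.
Qed.

Lemma negligible_cvg (e : nat -> R) : negligible e -> e @ \oo --> 0.
Proof.
move=> /(_ 1%N) [K HK]; apply/cvgrPdist_lt => eps eps0.
have [M0 HM0] := lg_unbounded (K / eps).
near=> M; rewrite sub0r normrN.
have leM : lg M0 <= lg M by apply: lg_homo; near: M; exact: nbhs_infty_ge.
have : K < eps * lg M by rewrite -ltr_pdivrMl // mulrC (lt_le_trans HM0).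
have := HK M; rewrite expr1 => H1 /(le_lt_trans H1).
by rewrite ltr_pM2r // lg_gt0.
Unshelve. all: by end_near. Qed.

Definition zeta u : R := limn (ms u).

Lemma ms_nil : ms [::] = fun M => (0 < M)%:R.
Proof.
apply/funext => -[|M]; first by rewrite /ms psum0.
by rewrite /ms /psum big_ord_recl /= big1 ?addr0.
Qed.

Lemma ms_nil_cvg : ms [::] @ \oo --> (1 : R).
Proof.
rewrite ms_nil; apply: cvg_near_cst.
by near=> M; apply/eqP; rewrite (_ : (0 < M)%N = true) //; near: M;
  exact: nbhs_infty_gt.
Unshelve. all: by end_near. Qed.

Lemma zeta_nil : zeta [::] = 1.
Proof. by apply/cvg_lim => //; exact: ms_nil_cvg. Qed.

Lemma h0_case v : h0 v -> v = [::] \/ exists2 v', v = false :: v' & v' != [::].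
Proof. by case: v => [|[] v] //; [left | right; exists v => //; case: v H]. Qed.

(** On the tail [lg M <= lg m], so the power of [lg M] moves under the sum, where [lg_sum_bounded]
    applies. With [c = 0] this gives convergence, with general [c] a negligible remainder. *)
Lemma ms_tail_le u c : u != [::] -> exists K, forall M N, (M <= N)%N ->
  (ms (false :: u) N - ms (false :: u) M) * lg M ^+ c <= K.
Proof.
move=> u0; have [K HK] := @lg_sum_bounded R (size u + c)%N.
exists K => M N /subnK <-.
apply: (@le_trans _ _ (\sum_(m < N - M + M) lg m ^+ (size u + c) / m%:R ^+ 2)).
  elim: (N - M)%N => [|k IH].
    rewrite subrr mul0r sumr_ge0 // => j _.
    by rewrite divr_ge0 ?exprn_ge0 ?lg_ge0.
  rewrite addSn /ms psumS addrAC mulrDl big_ord_recr /=; apply: lerD => //.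
  apply: (@le_trans _ _ (lg (k + M) ^+ size u / (k + M)%:R ^+ 2 * lg M ^+ c)).
    by rewrite ler_wpM2r ?exprn_ge0 ?lg_ge0 // mc_false_le.
  rewrite exprD [leRHS]mulrAC ler_wpM2l ?divr_ge0 ?exprn_ge0 ?lg_ge0 //.
  by rewrite lgX_homo // leq_addl.
case: (N - M + M)%N => [|n]; first by have := HK 0%N; rewrite !big_ord0.
by rewrite big_ord_recl expr0n invr0 mulr0 add0r.
Qed.

Lemma ms_nondecreasing u : {homo ms u : m n / (m <= n)%N >-> m <= n}.
Proof. by move=> m n; apply: ms_homo. Qed.

Lemma ms_cvg u : h0 u -> ms u @ \oo --> zeta u.
Proof.
case/h0_case => [->|[v -> v0]]; first by rewrite zeta_nil; exact: ms_nil_cvg.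
have [K HK] := ms_tail_le 0 v0.
apply: nondecreasing_is_cvgn; first exact: ms_nondecreasing.
exists K => _ [n _ <-]; have := HK 0%N n (leq0n _).
by rewrite expr0 mulr1 /ms psum0 subr0.
Qed.

Lemma zeta_tail u : h0 u -> negligible (fun M => zeta u - ms u M).
Proof.
move=> h0u c; have cv := ms_cvg h0u.
have ge M : ms u M <= zeta u.
  apply: nondecreasing_cvgn_le; first exact: ms_nondecreasing.
  by apply/cvg_ex; exists (zeta u).
case/h0_case: h0u cv ge => [->|[v -> v0]] cv ge.
  exists 1 => M; rewrite zeta_nil ms_nil.
  case: M => [|M]; last by rewrite subrr normr0 mul0r.
  by rewrite subr0 normr1 mul1r /lg big_ord0 addr0 expr1n.
have [K HK] := ms_tail_le c v0; exists K => M.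
rewrite ger0_norm ?subr_ge0 // -ler_pdivlMr ?exprn_gt0 ?lg_gt0 // lerBlDr.
apply: limr_le; first by apply/cvg_ex; exists (zeta (false :: v)).
near=> N; rewrite -lerBlDr ler_pdivlMr ?exprn_gt0 ?lg_gt0 //; apply: HK.
by near: N; exact: nbhs_infty_ge.
Unshelve. all: by end_near. Qed.

Lemma ms_le_zeta u M : h0 u -> ms u M <= zeta u.
Proof.
move=> h0u; apply: nondecreasing_cvgn_le; first exact: ms_nondecreasing.
by apply/cvg_ex; exists (zeta u); apply: ms_cvg.
Qed.

Lemma zeta_tailS u : h0 u -> negligible (fun M => zeta u - ms u M.+1).
Proof.
move=> h0u; apply: negligible_le (zeta_tail h0u) _ => M.
by rewrite ger0_norm ?subr_ge0 ?ms_le_zeta // lerD2l lerN2 ms_homo.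
Qed.

Lemma ms_bound u M : `|ms u M| <= 1 * lg M ^+ size u.
Proof. by rewrite ger0_norm ?ms_ge0 // mul1r ms_le. Qed.

(** Passing from the triangle of [ms_sh] to the full product costs [negligible_conv], and replacing
    the convergent factor by its limit costs [zeta_tailS]. The factor [u] may diverge, as
    regularization requires. *)
Lemma ms_sh_asymp u v : h1 u -> h0 v ->
  negligible (fun M => \sum_(x <- shuffle u v) ms x M - zeta v * ms u M).
Proof.
move=> h1u h0v.
have [->|v0] := eqVneq v [::].
  apply: eq_negligible (negligible0 R) => M.
  by rewrite sum_shs0 zeta_nil mul1r subrr.
have [->|u0] := eqVneq u [::].
  have H := negligibleD (negligibleZ (-1) (zeta_tail h0v))
   (negligibleZ (zeta v) (zeta_tail (isT : h0 [::]))).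
  apply: eq_negligible H => M.
  by rewrite sum_sh0s zeta_nil; ring.
have H := negligibleZ (-1) (negligibleD
  (negligibleM (zeta_tailS h0v) (ms_bound u))
    (negligible_conv R h1u u0 h0v v0)).
apply: eq_negligible H => M.
rewrite ms_sh //; last by case/andP: h0v.
have -> : \sum_(i < M.+1) mc v i * (ms u M - ms u (M - i)) =
   ms v M.+1 * ms u M - \sum_(i < M.+1) mc v i * ms u (M - i).
  by rewrite /ms /psum big_distrl -sumrB; apply: eq_bigr => i _ /=;
    rewrite mulrBr.
by ring.
Qed.

Lemma h0_sh u v x : h0 u -> h0 v -> x \in shuffle u v -> h0 x.
Proof.
rewrite !h0E => /andP[/eqP lu h1u] /andP[/eqP lv h1v] xin.
by rewrite (h1_sh h1u h1v xin) (lead0_sh lu lv xin).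
Qed.

Lemma zeta_mul u v : h0 u -> h0 v -> zeta u * zeta v =
  \sum_(x <- shuffle u v) zeta x.
Proof.
move=> h0u h0v; have h1u : h1 u by case/andP: h0u.
have lim1 : (fun M => \sum_(x <- shuffle u v) ms x M - zeta v * ms u M) @ \oo
  -->
    \sum_(x <- shuffle u v) zeta x - zeta v * zeta u.
  apply: cvgB; last by apply: cvgMr; apply: ms_cvg.
  by apply: cvgn_sum => x xin; apply: ms_cvg; apply: h0_sh xin.
apply/eqP; rewrite mulrC -subr_eq0 -oppr_eq0 opprB; apply/eqP.
exact: (cvg_unique (@norm_hausdorff _ _) lim1
  (negligible_cvg (ms_sh_asymp h1u h0v))).
Qed.

(** Shuffle regularization at the outer end, with value 0 at the divergent word [[:: true]]. *)
Definition z1 := ext true zeta.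

Lemma z1_h0 u : h0 u -> z1 u = zeta u.
Proof.
by rewrite h0E => /andP[/eqP lu _]; rewrite /z1 ext_lead0 // zeta_nil.
Qed.

Lemma z1_mul u v : h1 u -> h1 v -> z1 u * z1 v = \sum_(x <- shuffle u v) z1 x.
Proof.
apply: (ext_mul (D := h1)) => //; first exact: zeta_nil.
- exact: h1_sh.
- by move=> x y h1x h1y lx ly; apply: zeta_mul; rewrite h0E ?lx ?ly.
Qed.

Lemma z1_nil : z1 [::] = 1.
Proof. by rewrite z1_h0 // zeta_nil. Qed.

(** Regularization at the inner end as well: trailing letters [false] are treated by reversal, with
    [z1] as base. *)
Definition zsh u := ext false (z1 \o rev) (rev u).

Lemma zsh_h1 u : h1 u -> zsh u = z1 u.
Proof.
move=> h1u; rewrite /zsh (ext_lead0 (f := z1 \o rev) z1_nil) /= ?revK //.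
apply/eqP; elim/last_ind: u h1u => // u b _.
by rewrite /h1 last_rcons rev_rcons lead0_cons => ->.
Qed.

Lemma zsh_mul u v : zsh u * zsh v = \sum_(x <- shuffle u v) zsh x.
Proof.
rewrite /zsh -sum_sh_rev.
apply: (ext_mul (D := predT) (f := z1 \o rev) z1_nil) => //=.
move=> x y _ _ lx ly; rewrite -sum_sh_rev.
have h1_rev t : lead false t = 0%N -> h1 (rev t).
  case: t => // b t /eqP; rewrite lead0_cons rev_cons /h1 last_rcons.
  by case: b.
by rewrite z1_mul ?h1_rev.
Qed.

(** A word is the sum over [j] of [nseq j true] shuffled with the regularization of the word
    stripped of [j] leading letters [true]. Here [z1] evaluates the regularized part and [phi] the
    run, so that [phi] can carry the divergent sums. *)
Fixpoint z1_expand (phi : nat -> R) z : R :=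
  z1 z * phi 0%N +
  (if z is true :: z' then z1_expand (fun j => phi j.+1) z' else 0).

Lemma z1_nseq n : z1 (nseq n true) = (n == 0)%:R.
Proof. exact: ext_nseq. Qed.

Lemma z1_expand_nseq n phi : z1_expand phi (nseq n true) = phi n.
Proof.
elim: n phi => [|n IH] phi; first by rewrite /= (z1_nseq 0) mul1r addr0.
by rewrite [LHS]/= IH (z1_nseq n.+1) mul0r add0r.
Qed.

(** Only the shift of [phi] survives in the recursion, because [z1] kills the shuffle with a
    nonempty run of [true]. *)
Lemma sum_z1_expand n x phi : lead true x = 0%N -> h1 x ->
  \sum_(z <- shuffle (nseq n true) x) z1_expand phi z = phi n * z1 x.
Proof.
move=> lx h1x; elim: n phi => [|n IH] phi.
  rewrite sum_sh0s; case: x lx h1x => [|[] x] // _ _;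
    last by rewrite /= addr0 mulrC.
  by rewrite /= addr0 mulrC.
case: x lx h1x IH => [|[] x] // lx h1x IH.
  by rewrite sum_shs0 z1_expand_nseq z1_h0 // zeta_nil mulr1.
rewrite [nseq n.+1 _]/= sum_sh_cons /=.
under eq_bigr do rewrite /=.
rewrite big_split /= IH.
under [X in _ + X]eq_bigr do rewrite addr0.
rewrite addrAC -!big_distrl /= -mulrDl -sum_sh_cons.
rewrite -[true :: _]/(nseq n.+1 true).
rewrite -z1_mul // ?z1_nseq; first by rewrite mul0r mul0r add0r.
by rewrite /h1; elim: (n).
Qed.

Lemma sum_sh_nseq_lead (V : nmodType) (f : seq bool -> V) n a c x :
  \sum_(z <- shuffle (nseq n a) (c :: x)) f z =
  \sum_(j < n.+1) \sum_(y <- shuffle (nseq (n - j) a) x) f (nseq j a ++ c :: y).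
Proof.
elim: n f => [|n IH] f; first by rewrite sum_sh0s big_ord1 sum_sh0s.
rewrite [nseq n.+1 _]/= sum_sh_cons IH [RHS]big_ord_recl subn0 addrC.
by congr (_ + _); apply: eq_bigr => j _; rewrite lift0 subSS.
Qed.

(* The regularization theorem in elementary form: by [ms_sh_asymp] the shuffle
   of [n] letters [true] with an admissible [x] has truncated sum
   [zeta x * ms (nseq n true)] up to a negligible error, and so has
   [z1_expand] by [sum_z1_expand]. *)
Lemma ms_asymp u : h1 u ->
  negligible (fun M => ms u M - z1_expand (fun j => ms (nseq j true) M) u).
Proof.
have [x [Eu lx]] := leadP true u; move: (lead true u) Eu => n ->{u}.
elim/ltn_ind: n x lx => n IH x lx Hn.
case: x lx Hn => [|c x] lx Hn.
  apply: eq_negligible (negligible0 R) => M.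
  by rewrite cats0 z1_expand_nseq subrr.
have cF : c = false by move/eqP: lx; rewrite lead0_cons; case: (c).
have h1x : h1 (c :: x) by move: Hn; rewrite /h1 last_cat; elim: (n).
have h0x : h0 (c :: x) by rewrite h0E lx.
pose X z M := ms z M - z1_expand (fun j => ms (nseq j true) M) z.
have N : negligible (fun M => \sum_(z <- shuffle (nseq n true) (c :: x)) X z M).
  have h1n : h1 (nseq n true) by rewrite /h1; elim: (n).
  apply: eq_negligible (ms_sh_asymp h1n h0x) => M.
  by rewrite /X sumrB sum_z1_expand // z1_h0 // mulrC.
(* The word with its whole run in front occurs once, at [j = n]; [Y] collects the others, which have
   shorter runs and fall under the induction. *)
pose Y M := \sum_(j < n) \sum_(y <- shuffle (nseq (n - j) true) x) X
  (nseq j true ++ c :: y) M.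
apply: (@eq_negligible _ (fun M => \sum_(z <- shuffle (nseq n true) (c :: x)) X
  z M + Y M * (-1))).
  move=> M; rewrite sum_sh_nseq_lead big_ord_recr /= subnn sum_sh0s /Y.
  by rewrite mulrN1 addrAC subrr add0r.
apply: negligibleD => //; apply: negligibleZ.
apply: negligible_sum => j _; apply: negligible_sum => y yin.
apply: IH => //; first by apply/eqP; rewrite lead0_cons cF.
have h1k : h1 (nseq (n - j) true) by rewrite /h1; elim: (n - j)%N.
have h1y : h1 y := h1_sh h1k (h1_tail h1x) yin.
have : y != [::].
  by rewrite -size_eq0 (size_sh yin) size_nseq addn_eq0 subn_eq0 leqNgt ltn_ord.
by rewrite /h1 last_cat; case: y h1y {yin} => // b y h1y _ /=;
  elim: (nat_of_ord j).
Qed.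

End Zeta.

(** * Duality by connected sums *)

Section Duality.
Variable R : realType.
Implicit Types (u v x : seq bool).
Local Notation mc := (@mc R).
Local Notation ms := (@ms R).
Local Notation lg := (@lg R).
Local Notation zeta := (@zeta R).

(* The connector of Seki and Yamamoto's connected sums; by [connectorS] a letter
   can be carried from one side of the pairing to the other, as its dual. *)
Definition connector m n : R := (m`! * n`!)%:R / ((m + n)`!)%:R.

Lemma connector_ge0 m n : 0 <= connector m n.
Proof. by rewrite divr_ge0. Qed.

Lemma connectorC m n : connector m n = connector n m.
Proof. by rewrite /connector mulnC addnC. Qed.

Lemma connector0 m : connector m 0 = 1.
Proof. by rewrite /connector muln1 addn0 divff // pnatr_eq0 -lt0n fact_gt0. Qed.

Lemma connectorS m n : connector m.+1 n.+1 * (n.+1%:R^-1 + m.+1%:R^-1) =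
  connector m.+1 n / m.+1%:R.
Proof.
have : (m.+1 + n).+1%:R = m.+1%:R + n.+1%:R :> R by rewrite -addnS natrD.
rewrite /connector addnS; move: (m.+1 + n)%N => p E.
rewrite !factS !natrM.
have m0 : m.+1%:R != 0 :> R by rewrite pnatr_eq0.
have n0 : n.+1%:R != 0 :> R by rewrite pnatr_eq0.
have s0 : p.+1%:R != 0 :> R by rewrite pnatr_eq0.
have f0 : p`!%:R != 0 :> R by rewrite pnatr_eq0 -lt0n fact_gt0.
rewrite E in s0 *; move: s0 f0 m0 n0.
move: (m.+1%:R : R) (n.+1%:R : R) (p`!%:R : R) (m`!%:R : R) (n`!%:R : R).
by move=> a b c d e s0 f0 m0 n0; field; rewrite m0 n0 f0 s0.
Qed.

Lemma connector_le m n : connector m.+1 n <= m.+1%:R / n.+1%:R.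
Proof.
elim: n => [|n IH].
  by rewrite connector0 divr1 ler1n.
have H := connectorS m n.
have c0 := connector_ge0 m.+1 n.+1.
have : connector m.+1 n.+1 = connector m.+1 n * (n.+1%:R / (m.+1 + n.+1)%:R).
  have s0 : (m.+1 + n.+1)%:R != 0 :> R by rewrite pnatr_eq0.
  have m0 : m.+1%:R != 0 :> R by rewrite pnatr_eq0.
  have n0 : n.+1%:R != 0 :> R by rewrite pnatr_eq0.
  move: H; rewrite natrD in s0 *; move: (m.+1%:R : R) (n.+1%:R : R) m0 n0 s0.
  move=> a b a0 b0 s0 H; apply: (mulIf (_ : b^-1 + a^-1 != 0)).
    have -> : b^-1 + a^-1 = (a + b) / (a * b) by field; rewrite a0 b0.
    by rewrite mulf_neq0 // invr_eq0 mulf_neq0.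
  by rewrite H; field; rewrite a0 b0 s0.
move=> ->; apply: le_trans
  (_ : m.+1%:R / n.+1%:R * (n.+1%:R / (m.+1 + n.+1)%:R) <= _).
  by rewrite ler_wpM2r // divr_ge0.
rewrite mulrA divfK ?pnatr_eq0 // ler_wpM2l // lef_pV2 ?posrE ?ltr0n //.
by rewrite ler_nat addSn ltnS leq_addl.
Qed.

(** Summation by parts through [connectorS]; the second term on the left is the boundary term. *)
Lemma connector_abel m v N :
  \sum_(b < N.+1) connector m.+1 b * mc (true :: v) b +
    connector m.+1 N * ms v N / m.+1%:R =
  \sum_(n < N) connector m.+1 n / m.+1%:R * mc v n.
Proof.
elim: N => [|N IH].
  by rewrite big_ord1 mc_cons0 /ms psum0 !mulr0 mul0r addr0 big_ord0.
rewrite [RHS]big_ord_recr -IH big_ord_recr [mc (true :: v) N.+1]/= -/(ms v).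
rewrite /ms psumS; have := connectorS m N.
move: (connector _ _) (connector _ _) (\sum_(_ < _) _) => a b s E.
have -> : forall x : R, a * x / m.+1%:R = a / m.+1%:R * x by move=> x; ring.
by rewrite -E /=; ring.
Qed.

(** Taken in the extended reals, where a nonnegative double series exists and may be interchanged
    without a proof of convergence. *)
Definition pairing u v : \bar R :=
  (\sum_(m <oo) \sum_(n <oo) (mc u m * (connector m n * mc v n))%:E)%E.

Lemma pairing_ge0 u v m n : (0 <= (mc u m * (connector m n * mc v n))%:E)%E.
Proof. by rewrite lee_fin !mulr_ge0 ?mc_ge0 ?connector_ge0. Qed.

Lemma pairingC u v : pairing u v = pairing v u.
Proof.
rewrite /pairing nneseries_interchange; last by move=> m n; exact: pairing_ge0.
apply: eq_eseriesr => m _; apply: eq_eseriesr => n _.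
by rewrite connectorC; congr _%:E; ring.
Qed.

(** Row by row in [m], [connector_abel] equates partial sums up to its boundary term, which
    [connector_le] sends to 0. Row 0 is zero on both sides because [u] is nonempty. *)
Lemma pairing_move u v : u != [::] -> pairing (false :: u) v =
  pairing u (true :: v).
Proof.
move=> u0; apply: eq_eseriesr => -[_|m _].
  case: u u0 => // b u _.
  by rewrite !eseries0 // => n _ _; rewrite mc_cons0 mul0r.
pose A N : R := \sum_(n < N) mc (false :: u) m.+1 * (connector m.+1 n * mc v n).
pose B N : R := \sum_(n < N) mc u m.+1 * (connector m.+1 n * mc (true :: v) n).
pose e N : R := mc u m.+1 * (connector m.+1 N * ms v N / m.+1%:R).
have AB N : A N = B N.+1 + e N.
  have -> : B N.+1 + e N = mc u m.+1 * (\sum_(b < N.+1) connector m.+1 b *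
      mc (true :: v) b + connector m.+1 N * ms v N / m.+1%:R).
    by rewrite mulrDr big_distrr.
  rewrite connector_abel big_distrr /A; apply: eq_bigr => n _.
  by rewrite -[mc (false :: u) m.+1]/(mc u m.+1 / m.+1%:R) /=; ring.
have e0 : e @ \oo --> (0 : R).
  apply: negligible_cvg.
  have H := negligibleZ (mc u m.+1) (negligible_lg R (size v)).
  apply: negligible_le H _ => M.
  rewrite ger0_norm; last by rewrite /e !mulr_ge0 ?mc_ge0 ?connector_ge0
    ?ms_ge0.
  rewrite /e mulrC ler_wpM2r ?mc_ge0 // ler_pdivrMr ?ltr0n //.
  apply: le_trans (_ : m.+1%:R / M.+1%:R * lg M ^+ size v <= _).
    by apply: ler_pM; rewrite ?connector_ge0 ?ms_ge0 ?connector_le ?ms_le.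
  by rewrite le_eqVlt; apply/orP; left; apply/eqP; ring.
have sumE u' v' N : (\sum_(0 <= n < N)
  (mc u' m.+1 * (connector m.+1 n * mc v' n))%:E)%E =
    (\sum_(n < N) mc u' m.+1 * (connector m.+1 n * mc v' n))%:E.
  by rewrite big_mkord sumEFin.
have cvgE (f : nat -> \bar R) : (forall n, 0 <= f n)%E ->
    (fun N => \sum_(0 <= n < N) f n)%E @ \oo --> (\sum_(n <oo) f n)%E.
  by move=> f0; apply: is_cvg_nneseries.
have cB : (fun N => (B N.+1)%:E) @ \oo -->
    (\sum_(n <oo) (mc u m.+1 * (connector m.+1 n * mc (true :: v) n))%:E)%E.
  have := cvgE (fun n => (mc u m.+1 * (connector m.+1 n * mc (true :: v) n))%:E)
     (pairing_ge0 u (true :: v) m.+1).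
  rewrite -(cvg_shiftS (fun N => \sum_(0 <= n < N) _)%E).
  by under eq_fun do rewrite sumE.
have ce : (fun N => (e N)%:E) @ \oo --> 0%E by apply: cvg_EFin e0; near=> N.
apply: cvg_lim => //; under eq_fun do rewrite sumE -/(A _) AB EFinD.
by have := cvgeD (fin_num_adde_defl _ _) cB ce; rewrite adde0; apply.
Unshelve. all: by end_near. Qed.

Lemma pairing_nil u : h0 u -> pairing u [::] = (zeta u)%:E.
Proof.
move=> h0u; have inner m : (\sum_(n <oo)
  (mc u m * (connector m n * mc [::] n))%:E)%E = (mc u m)%:E.
  rewrite nneseries_recl //; last by move=> n _; exact: pairing_ge0.
  rewrite connector0 !mulr1 eseries0 ?adde0 // => -[|n] // _ _.
  by rewrite /= !mulr0.
rewrite /pairing; under eq_eseriesr do rewrite inner.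
apply: cvg_lim => //; under eq_fun do rewrite big_mkord sumEFin.
by apply: cvg_EFin (ms_cvg h0u); near=> N.
Unshelve. all: by end_near. Qed.

Lemma pairing_catrev u v : h1 u -> v != [::] ->
  pairing u v = pairing [::] (catrev (map negb u) v).
Proof.
elim: u v => [|b u IH] v h1u v0 //=.
rewrite -IH //; last exact: h1_tail h1u.
case: b h1u => h1u; last by apply: pairing_move; case: u h1u {IH}.
by rewrite pairingC [RHS]pairingC -pairing_move.
Qed.

Lemma h0_dual u : h0 u -> h0 (rev (map negb u)).
Proof.
move=> h0u; case/h0_case: (h0u) => [->//|[v E v0]].
have h1v : h1 v by case/andP: h0u => _; rewrite E; apply: h1_tail.
rewrite /h0 E /= rev_cons /h1 last_rcons andbT.
case/lastP: v v0 h1v {E} => // v b _; rewrite /h1 last_rcons => ->.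
by rewrite map_rcons rev_rcons.
Qed.

(** Carrying all letters across the pairing complements and reverses them. The first one moves
    separately, to provide the nonempty right word that [pairing_catrev] asks for. *)
Theorem zeta_dual u : h0 u -> zeta (rev (map negb u)) = zeta u.
Proof.
move=> h0u; case/h0_case: (h0u) => [->//|[v E v0]].
have h1v : h1 v by case/andP: h0u => _; rewrite E; apply: h1_tail.
have h0r := h0_dual h0u.
have := pairing_catrev h1v (isT : [:: true] != [::]).
rewrite -pairing_move // -E pairing_nil // pairingC.
have -> : catrev (map negb v) [:: true] = rev (map negb u).
  by rewrite E /= catrevE rev_cons cats1.
by rewrite pairing_nil // => -[].
Qed.

End Duality.

(** * Indices and quasi-symmetric sums *)

Section QuasiSymmetric.
Variable R : comPzRingType.
Implicit Types (k u v : seq nat) (xs ys : seq R).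

(* The monomial quasi-symmetric function of [k] in the variables [xs]. *)
Fixpoint qs k xs : R :=
  if xs is x :: xs' then
    qs k xs' + (if k is a :: k' then x ^+ a * qs k' xs' else 0)
  else (k == [::])%:R.

Lemma qs_nil xs : qs [::] xs = 1.
Proof. by elim: xs => //= x xs ->; rewrite addr0. Qed.

(** The index is cut where the chosen variables pass from [xs] to [ys]. *)
Lemma qs_cat k xs ys : qs k (xs ++ ys) =
  \sum_(i < (size k).+1) qs (take i k) xs * qs (drop i k) ys.
Proof.
elim: xs k => [|x xs IH] k.
  rewrite big_ord_recl take0 drop0 mul1r big1 ?addr0 // => i _.
  by case: k i => [[]|a k i] //=; rewrite mul0r.
rewrite [LHS]/= IH; case: k => [|a k].
  by rewrite !big_ord1 /= !qs_nil; ring.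
rewrite IH big_ord_recl [RHS]big_ord_recl !take0 !drop0 !qs_nil -addrA.
congr (_ + _); rewrite big_distrr -big_split /=; apply: eq_bigr => i _.
by ring.
Qed.

Lemma qs_rcons k a xs x :
  qs (rcons k a) (rcons xs x) = qs (rcons k a) xs + x ^+ a * qs k xs.
Proof.
elim: xs k => [|y xs IH] [|b k] /=; rewrite ?mulr0 ?addr0 //.
- by case: k => [|c k] /=; rewrite !mulr0 ?addr0.
- by have := IH [::] => /= ->; rewrite !qs_nil; ring.
- by have := IH (b :: k) => /= ->; rewrite IH; ring.
Qed.

Lemma qs_rev k xs : qs (rev k) (rev xs) = qs k xs.
Proof.
elim: xs k => [|x xs IH] [|a k].
- by [].
- by rewrite rev_cons /=; case: (rev k).
- by rewrite !qs_nil.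
- by rewrite !rev_cons qs_rcons -rev_cons !IH.
Qed.

Lemma qs_opp k xs : qs k (map -%R xs) = (-1) ^+ sumn k * qs k xs.
Proof.
elim: xs k => [|x xs IH] [|a k] /=; rewrite ?IH ?mul1r ?mulr0 //=.
by rewrite -[- x]mulN1r exprMn exprD; ring.
Qed.

Fixpoint stuffle u : seq nat -> seq (seq nat) :=
  if u is a :: u' then
    fix stuffle' v := if v is b :: v' then
      map (cons a) (stuffle u' v) ++ map (cons b) (stuffle' v') ++
      map (cons (a + b)%N) (stuffle u' v')
    else [:: u]
  else fun v => [:: v].

#[local] Arguments stuffle : simpl never.

Lemma st_cons a u b v : stuffle (a :: u) (b :: v) =
  map (cons a) (stuffle u (b :: v)) ++ map (cons b) (stuffle (a :: u) v) ++
  map (cons (a + b)%N) (stuffle u v).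
Proof. by []. Qed.

Lemma qs_mul u v xs : qs u xs * qs v xs = \sum_(t <- stuffle u v) qs t xs.
Proof.
elim: xs u v => [|x xs IH] [|a u]; try by move=> v;
  rewrite qs_nil mul1r big_seq1.
  case=> [|b v]; first by rewrite qs_nil mulr1 big_seq1.
  by rewrite st_cons !big_cat !big_map /= mul0r !big1 // !addr0.
case=> [|b v]; first by rewrite qs_nil mulr1 big_seq1.
have := IH (a :: u) (b :: v); rewrite !st_cons !big_cat !big_map /= => E.
rewrite !big_split /= -!big_distrr /= -!IH exprD mulrDl !mulrDr E.
by ring.
Qed.

Lemma st_weight u v t : t \in stuffle u v -> sumn t = (sumn u + sumn v)%N.
Proof.
elim: u v t => [v t|a u IHu]; first by rewrite /stuffle inE => /eqP->.
elim=> [t|b v IHv t]; first by rewrite /stuffle inE => /eqP->; rewrite addn0.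
rewrite st_cons !mem_cat => /or3P[] /mapP[s + ->] /=.
- by move=> /IHu ->; rewrite addnA.
- by move=> /IHv ->; rewrite addnCA.
- by move=> /IHu ->; rewrite addnACA.
Qed.

Lemma st_index u v t : all (leq 1) u -> all (leq 1) v -> t \in stuffle u v ->
  all (leq 1) t.
Proof.
elim: u v t => [v t _ Hv|a u IHu]; first by rewrite /stuffle inE => /eqP->.
elim=> [t Hu _|b v IHv t Hu Hv]; first by rewrite /stuffle inE => /eqP->.
have /andP[a0 Hu'] := Hu; have /andP[b0 Hv'] := Hv.
rewrite st_cons !mem_cat => /or3P[] /mapP[s + ->] /=.
- by move=> /IHu ->; rewrite ?a0.
- by move=> /IHv ->; rewrite ?b0.
- by move=> /IHu ->; rewrite ?addn_gt0 ?a0.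
Qed.

End QuasiSymmetric.

(** * Words of indices and their truncated sums *)

Section Indices.
Variable R : realType.
Implicit Types (k : seq nat) (u v x : seq bool).
Local Notation mc := (@mc R).
Local Notation ms := (@ms R).
Local Notation zeta := (@zeta R).
Local Notation z1 := (@z1 R).

(* The word of the index [rev k], outermost letter first. *)
Definition enc k : seq bool :=
  flatten [seq rcons (nseq a.-1 false) true | a <- k].

Lemma enc_cons a k : enc (a.+1 :: k) = nseq a false ++ true :: enc k.
Proof. by rewrite /enc /= cat_rcons. Qed.

Lemma size_enc k : all (leq 1) k -> size (enc k) = sumn k.
Proof.
elim: k => // -[//|a] k IH /= /IH.
by rewrite enc_cons size_cat size_nseq /= addSnnS => ->.
Qed.

Lemma h1_enc k : all (leq 1) k -> h1 (enc k).
Proof.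
elim: k => // -[//|a] k IH /= /IH.
by rewrite enc_cons /h1 last_cat.
Qed.

Lemma enc_surj x : h1 x -> exists k, all (leq 1) k /\ enc k = x.
Proof.
elim: x => [|b x IH] h1x; first by exists [::].
have [k [Hk E]] := IH (h1_tail h1x).
case: b h1x => h1x; first by exists (1%N :: k); rewrite enc_cons E.
case: k Hk E => [|[//|a] k] /= Hk E; first by rewrite -E in h1x.
by exists (a.+2 :: k); split=> //; rewrite -E !enc_cons.
Qed.

Lemma mc_enc a k m : mc (enc (a.+1 :: k)) m = ms (enc k) m / m%:R ^+ a.+1.
Proof.
rewrite enc_cons; elim: a => [|a IH] //=.
by rewrite IH [in RHS]exprSr invfM mulrA.
Qed.

Definition desc M : seq R := [seq m%:R^-1 | m <- rev (iota 1 M)].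

Lemma descS M : desc M.+1 = M.+1%:R^-1 :: desc M.
Proof. by rewrite /desc -{1}[M.+1]addn1 iotaD rev_cat /= add1n. Qed.

Lemma ms_enc k M : all (leq 1) k -> ms (enc k) M.+1 = qs k (desc M).
Proof.
elim: M k => [|M IH] k Hk.
  rewrite /ms psumS psum0 add0r; case: k Hk => [|[//|a] k] // _.
  by rewrite mc_enc expr0n invr0 mulr0.
rewrite descS /ms psumS -/(ms _) IH //=.
case: k Hk => [|[//|a] k] Hk /=; first by rewrite addr0.
by rewrite mc_enc IH // exprVn mulrC.
Qed.

(* The truncated finite real multiple zeta value, cut between the positive and
   the negative summation variables. *)
Definition fs k M : R := \sum_(i < (size k).+1) (-1) ^+ sumn (drop i k) *
  (ms (enc (rev (take i k))) M * ms (enc (drop i k)) M).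

(** The reciprocals come in the decreasing order [1, 1/2, ..., 1/M, -1/M, ..., -1]; the cut made by
    [qs_cat] is the change of sign. The strict bound on the variables is [M.+1]. *)
Lemma fsE k M : all (leq 1) k ->
  fs k M.+1 = qs k (rev (desc M) ++ map -%R (desc M)).
Proof.
move=> Hk; rewrite qs_cat; apply: eq_bigr => i _.
rewrite qs_opp -[take i k in RHS]revK qs_rev !ms_enc ?all_rev.
- by ring.
- by move: Hk; rewrite -{1}(cat_take_drop i k) all_cat => /andP[].
- by move: Hk; rewrite -{1}(cat_take_drop i k) all_cat => /andP[].
Qed.

(** The condition [p <= q] is built in so that double sums can run over full ranges. *)
Definition ones k p q := (p <= q)%N && all (pred1 1%N)
  (take (q - p) (drop p k)).

Lemma z1_expand_enc k phi : all (leq 1) k -> z1_expand phi (enc k) =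
  \sum_(j < (size k).+1 | all (pred1 1%N) (take j k)) z1 (enc (drop j k))
    * phi j.
Proof.
elim: k phi => [|[//|a] k IH] phi /= Hk.
  by rewrite big_mkcond big_ord1 /= addr0.
rewrite [RHS]big_mkcond big_ord_recl take0 drop0 /= enc_cons.
case: a => [|a] /=; last by rewrite big1 // => j _.
by rewrite IH // big_mkcond.
Qed.

End Indices.

(** * Finite real multiple zeta values *)

Section FiniteReal.
Variable R : realType.
Implicit Types (k : seq nat) (u v x : seq bool).
Local Notation ms := (@ms R).
Local Notation zeta := (@zeta R).
Local Notation z1 := (@z1 R).
Local Notation fs := (@fs R).

Lemma big_shift (F : nat -> R) m n :
  \sum_(m <= i < n) F i = \sum_(0 <= j < n - m) F (j + m)%N.
Proof. by rewrite -{1}[m]add0n big_addn. Qed.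

Definition lower k p : R := z1 (enc (rev (take p k))).
Definition upper k q : R := z1 (enc (drop q k)).

Lemma ones_split k p i q : (p <= i <= q)%N ->
  ones k p q = ones k p i && ones k i q.
Proof.
move=> /andP[pi iq]; rewrite /ones pi iq (leq_trans pi iq) /=.
have -> : (q - p = (i - p) + (q - i))%N by rewrite addnC addnBA // subnK.
by rewrite takeD all_cat drop_drop subnK.
Qed.

Lemma ones_sumn k p q : (q <= size k)%N -> ones k p q ->
  sumn (drop p k) = (q - p + sumn (drop q k))%N.
Proof.
move=> qk /andP[pq /all_pred1P E].
rewrite -{1}(cat_take_drop (q - p) (drop p k)) sumn_cat drop_drop subnK //.
rewrite E sumn_nseq mul1n size_take size_drop; congr (_ + _)%N.
by case: ltngtP (leq_sub2r p qk).
Qed.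

Lemma z1_expand_lower k i phi : all (leq 1) k -> (i <= size k)%N ->
  z1_expand phi (enc (rev (take i k))) =
  \sum_(0 <= p < (size k).+1) (ones k p i)%:R * (lower k p * phi (i - p)%N).
Proof.
move=> Hk ik; have Hi : all (leq 1) (rev (take i k)).
  by rewrite all_rev; move: Hk;
    rewrite -{1}(cat_take_drop i k) all_cat => /andP[].
rewrite z1_expand_enc // size_rev size_takel // (reindex_inj rev_ord_inj) /=.
rewrite (big_cat_nat (n := i.+1)) //= [X in _ + X]big_nat_cond.
rewrite [X in _ + X]big1 ?addr0; last first.
  by move=> p /andP[/andP[pi _] _]; rewrite /ones leqNgt pi mul0r.
rewrite big_mkord big_mkcond; apply: eq_bigr => p _ /=.
have pi : (p <= i)%N by rewrite -ltnS.
rewrite /ones pi subSS take_rev drop_rev size_takel // subKn // all_rev.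
rewrite take_takel // take_drop subnK // /lower.
by case: ifP => _; rewrite ?mul1r ?mul0r.
Qed.

Lemma z1_expand_upper k i phi : all (leq 1) k -> (i <= size k)%N ->
  z1_expand phi (enc (drop i k)) =
  \sum_(0 <= q < (size k).+1) (ones k i q)%:R * (upper k q * phi (q - i)%N).
Proof.
move=> Hk ik; have Hi : all (leq 1) (drop i k).
  by move: Hk; rewrite -{1}(cat_take_drop i k) all_cat => /andP[].
rewrite z1_expand_enc // size_drop.
rewrite (big_cat_nat (n := i)) //=; last by rewrite ltnW.
rewrite [X in _ = X + _]big_nat_cond [X in _ = X + _]big1 ?add0r; last first.
  by move=> q /andP[/andP[_ qi] _]; rewrite /ones leqNgt qi mul0r.
rewrite big_shift subSn // big_mkord big_mkcond; apply: eq_bigr => q _ /=.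
rewrite /ones leq_addl addnK drop_drop.
by case: ifP => _; rewrite ?mul1r ?mul0r.
Qed.

(** The truncated finite value of [s] entries 1, when [sigma j] is [ms (nseq j true) M]. *)
Definition ones_conv (sigma : nat -> R) s : R :=
  \sum_(0 <= i < s.+1) (-1) ^+ (s - i) * (sigma i * sigma (s - i)%N).

(** The two expansions strip ones on either side of the cut [i], down to [p] and up to [q]. For
    fixed [p] and [q] the cut runs through a block of ones, and the sum over it is [ones_conv]. *)
Lemma regroup k sigma : all (leq 1) k ->
  \sum_(0 <= i < (size k).+1) (-1) ^+ sumn (drop i k) *
    (z1_expand sigma (enc (rev (take i k))) * z1_expand sigma
      (enc (drop i k))) =
  \sum_(0 <= p < (size k).+1) \sum_(0 <= q < (size k).+1)
    (ones k p q)%:R * ((-1) ^+ sumn (drop q k) * (lower k p * upper k q)) *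
    ones_conv sigma (q - p)%N.
Proof.
move=> Hk; set N := (size k).+1.
transitivity (\sum_(0 <= i < N) \sum_(0 <= p < N) \sum_(0 <= q < N)
   (ones k p i)%:R * (ones k i q)%:R * ((-1) ^+ sumn (drop i k) *
     (lower k p * upper k q) * (sigma (i - p)%N * sigma (q - i)%N))).
  rewrite big_nat [RHS]big_nat; apply: eq_bigr => i /= iN.
  rewrite z1_expand_lower // z1_expand_upper // mulr_suml mulr_sumr.
  apply: eq_bigr => p _; rewrite mulr_sumr mulr_sumr; apply: eq_bigr => q _.
  by ring.
rewrite exchange_big /=; apply: eq_bigr => p _.
rewrite exchange_big /= big_nat [RHS]big_nat; apply: eq_bigr => q /= qN.
case Opq : (ones k p q); last first.
  rewrite !mul0r big1 // => i _; rewrite -natrM mulnb.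
  case: (boolP (_ && _)) => [/andP[Opi Oiq]|]; last by rewrite mul0r.
  have /andP[pi _] := Opi; have /andP[iq _] := Oiq.
  by move: Opq; rewrite (ones_split _ (i := i)) ?pi // Opi Oiq.
have /andP[pq _] := Opq.
rewrite mul1r (big_cat_nat (n := p)) //=;
  last by rewrite (leq_trans pq) // ltnW.
rewrite big_nat_cond big1 ?add0r; last first.
  by move=> i /andP[/andP[_ ip] _]; rewrite /ones [(p <= i)%N]leqNgt ip !mul0r.
rewrite (big_cat_nat (n := q.+1)) //=; last by rewrite ltnW.
rewrite [X in _ + X]big_nat_cond [X in _ + X]big1 ?addr0; last first.
  by move=> i /andP[/andP[qi _] _];
    rewrite /ones [(i <= q)%N]leqNgt qi mulr0 mul0r.
rewrite big_shift subSn ?leqW // mulr_sumr.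
rewrite big_nat [RHS]big_nat; apply: eq_bigr => j /= jq.
have piq : (p <= j + p <= q)%N by rewrite leq_addl /= addnC -leq_subRL // -ltnS.
have := ones_split k piq; rewrite Opq => /esym /andP[-> O2].
rewrite O2 !mul1r (ones_sumn _ O2); last by rewrite -ltnS.
rewrite addnK [(j + p)%N]addnC subnDA exprD.
by ring.
Qed.

(* For [k = 1, ..., 1] the truncated sum is the elementary symmetric function of
   the numbers [1/m] with [0 < |m| < M], read off from
   [(1 + x/m) (1 - x/m) = 1 - x^2/m^2]. *)
Definition gen_poly (c : R) M : {poly R} :=
  \prod_(m < M) (1 + (c / m.+1%:R) *: 'X).

Lemma coef_gen_poly c M j :
  (gen_poly c M)`_j = c ^+ j * ms (nseq j true) M.+1.
Proof.
elim: M j => [|M IH] j.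
  rewrite /gen_poly big_ord0 coef1 /ms psumS psum0 add0r.
  by case: j => [|j]; rewrite ?mc_cons0 ?mulr0 //= mul1r.
rewrite /gen_poly big_ord_recr /= mulrDr mulr1 -scalerAr coefD coefZ coefMX.
rewrite -/(gen_poly c M) IH /ms [in RHS]psumS.
case: j => [|j] /=; first by rewrite !mulr0 !addr0.
by rewrite IH exprS /ms; ring.
Qed.

Lemma ones_conv_poly s M : ones_conv (fun j => ms (nseq j true) M.+1) s =
  (gen_poly 1 M * gen_poly (-1) M)`_s.
Proof.
rewrite coefM /ones_conv big_mkord; apply: eq_bigr => i _.
by rewrite !coef_gen_poly expr1n mul1r; ring.
Qed.

Definition ones_trunc s M : R :=
  if odd s then 0 else (-1) ^+ s./2 * ms (enc (nseq s./2 2)) M.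

Lemma ones_convE s M :
  ones_conv (fun j => ms (nseq j true) M.+1) s = ones_trunc s M.+1.
Proof.
rewrite ones_conv_poly /ones_trunc; elim: M s => [|M IH] s.
  rewrite /gen_poly !big_ord0 mulr1 coef1 /ms psumS psum0 add0r.
  case: s => [|[|s]] //=; first by rewrite mulr1.
  by case: ifP => // _; rewrite invr0 !mulr0.
have -> : gen_poly 1 M.+1 * gen_poly (-1) M.+1 =
    gen_poly 1 M * gen_poly (-1) M -
    (M.+1%:R ^+ 2)^-1 *: (gen_poly 1 M * gen_poly (-1) M * 'X^2).
  rewrite /gen_poly !big_ord_recr /= -/(gen_poly 1 M) -/(gen_poly (-1) M).
  have -> : ((M.+1%:R : R) ^+ 2)^-1 = M.+1%:R^-1 * M.+1%:R^-1.
    by rewrite expr2 invfM.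
  rewrite mulN1r scaleNr mul1r -!mul_polyC polyCM; by ring.
rewrite coefB coefZ coefMXn !IH.
case: s => [|[|s]] /=.
- by rewrite mulr0 subr0 !mul1r /ms [in RHS]psumS /= addr0.
- by rewrite mulr0 subr0.
rewrite negbK subn2 /=; case: ifP => _; first by rewrite mulr0 subr0.
rewrite -[in RHS]/(2%N :: nseq s./2 2) /ms [in RHS]psumS -/(ms _) mc_enc.
by rewrite exprS /ms; ring.
Qed.

Definition ones_lim s : R :=
  if odd s then 0 else (-1) ^+ s./2 * zeta (enc (nseq s./2 2)).

Lemma h0_enc_nseq2 n : h0 (enc (nseq n 2)).
Proof.
rewrite /h0 h1_enc; last by rewrite all_nseq orbT.
by case: n.
Qed.

Lemma ones_conv_cvg s :
  (fun M => ones_conv (fun j => ms (nseq j true) M) s) @ \oo --> ones_lim s.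
Proof.
have : ones_trunc s @ \oo --> ones_lim s.
  rewrite /ones_trunc /ones_lim; case: odd; first exact: cvg_cst.
  by apply: cvgMr; apply: ms_cvg; apply: h0_enc_nseq2.
rewrite -(cvg_shiftS (ones_trunc s))
  -(cvg_shiftS (fun M => ones_conv (fun j => ms (nseq j true) M) s)).
apply: cvg_trans; apply: near_eq_cvg; near=> M; by rewrite /= ones_convE.
Unshelve. all: by end_near. Qed.

(* The finite real multiple zeta value in terms of shuffle-regularized multiple
   zeta values: a run of ones is cut out of the middle of the index. *)
Definition zF k : R := \sum_(0 <= p < (size k).+1) \sum_(0 <= q < (size k).+1)
    (ones k p q)%:R * ((-1) ^+ sumn (drop q k) * (lower k p * upper k q)) *
    ones_lim (q - p)%N.

(** After [regroup], [main] depends on [M] only through the [ones_conv], which converge although the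
    separate factors need not. *)
Lemma fs_cvg k : all (leq 1) k -> fs k @ \oo --> zF k.
Proof.
move=> Hk.
pose sg M j := ms (nseq j true) M.
pose main M := \sum_(0 <= i < (size k).+1) (-1) ^+ sumn (drop i k) *
    (z1_expand (sg M) (enc (rev (take i k))) * z1_expand (sg M)
      (enc (drop i k))).
have main_cvg : main @ \oo --> zF k.
  rewrite /main; under eq_fun do rewrite regroup //.
  apply: cvgn_sum => p _; apply: cvgn_sum => q _.
  by apply: cvgMr; apply: ones_conv_cvg.
have diff : negligible (fun M => fs k M - main M).
  have N i : negligible (fun M => (-1) ^+ sumn (drop i k) *
      (ms (enc (rev (take i k))) M * ms (enc (drop i k)) M -
       z1_expand (sg M) (enc (rev (take i k))) * z1_expand (sg M)
         (enc (drop i k)))).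
    have := cat_take_drop i k; set A := take i k; set B := drop i k => AB.
    have [HA HB] : all (leq 1) (rev A) /\ all (leq 1) B.
      by rewrite all_rev; move: Hk; rewrite -AB all_cat => /andP[].
    have NA := ms_asymp R (h1_enc HA); have NB := ms_asymp R (h1_enc HB).
    have [K HK] := NB 0%N.
    have bB M : `|ms (enc B) M - z1_expand (sg M) (enc B)| <= K * lg R M ^+ 0.
      by have := HK M; rewrite expr0 !mulr1.
    (* This is [A B - A' B' = (A - A') B + (B - B') A - (A - A') (B - B')], which avoids bounding
       the expansions [A'] and [B'] themselves. *)
    have := negligibleZ ((-1) ^+ sumn B) (negligibleD (negligibleD
      (negligibleM NA (ms_bound R (enc B)))
        (negligibleM NB (ms_bound R (enc (rev A)))))
      (negligibleZ (-1) (negligibleM NA bB))).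
    by apply: eq_negligible => M; rewrite /sg; ring.
  have := negligible_sum (r := index_iota 0 (size k).+1) (fun i _ => N i).
  apply: eq_negligible => M; rewrite /main /fs !big_mkord -sumrB.
  by apply: eq_bigr => i _; rewrite mulrBr.
have -> : fs k = main + (fun M => fs k M - main M).
  by apply/funext => M; rewrite -[RHS]/(main M + (fs k M - main M)) subrKC.
by rewrite -[zF k]addr0; apply: cvgD => //; apply: negligible_cvg.
Qed.

End FiniteReal.

(** * The definitions as iterated sums *)

Section Subsequences.
Variable T : eqType.
Implicit Types (L s t : seq T) (n : nat).

Fixpoint subs n L : seq (seq T) :=
  if L is x :: L' then
    subs n L' ++ (if n is n'.+1 then map (cons x) (subs n' L') else [::])
  else if n is 0 then [:: [::]] else [::].

Lemma mem_subs n L t : (t \in subs n L) = (size t == n) && subseq t L.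
Proof.
elim: L n t => [|x L IH] n t /=.
  by case: n => [|n]; case: t => [|y t] //=; rewrite andbF.
rewrite mem_cat IH; case: n => [|n].
  by rewrite in_nil orbF; case: t => [|y t] //=; rewrite sub0seq.
case: t => [|y t] /=.
  by apply/negbTE/negP => /mapP[].
have -> : (y :: t \in map (cons x) (subs n L)) = (y == x) && (t \in subs n L).
  apply/mapP/andP => [[z zin [-> ->]] //|[/eqP-> tin]]; by exists t.
rewrite IH eqSS; case: (eqVneq y x) => [->|_] /=; last by rewrite orbF.
case: (size t == n) => //=.
by apply/idP/idP => [/orP[/cons_subseq|]//|->]; rewrite orbT.
Qed.

Lemma subs_uniq n L : uniq L -> uniq (subs n L).
Proof.
elim: L n => [|x L IH] n /=; first by case: n.
move=> /andP[xL uL]; rewrite cat_uniq IH //=; case: n => [|n] //.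
rewrite map_inj_uniq ?IH //; last by move=> ? ? [].
rewrite andbT.
apply/hasPn => _ /mapP[t _ ->]; rewrite mem_subs; apply: contra xL => /andP[_].
by move=> /mem_subseq; apply; rewrite mem_head.
Qed.

Lemma subseq_of_sorted (r : rel T) t L : transitive r -> irreflexive r ->
  sorted r L -> subseq t L = sorted r t && all (mem L) t.
Proof.
move=> r_tr r_irr sL; apply/idP/andP => [tL|[st /allP tL]].
  by split; [apply: subseq_sorted tL sL | apply/allP; apply: mem_subseq].
suff -> : t = [seq x <- L | x \in t] by apply: filter_subseq.
apply: (irr_sorted_eq r_tr r_irr) => //; first exact: sorted_filter.
by move=> x; rewrite mem_filter; apply/idP/andP => [xt|[]//]; split=> //;
  apply: tL.
Qed.

End Subsequences.

Section SortedTuples.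
Variables (T : choiceType) (R : comPzRingType).
Implicit Types (L t : seq T) (k : seq nat) (f : T -> R).

Definition monomial f k t : R := \prod_(i < size k) nth 0 (map f t) i ^+ nth 0%N
  k i.

Lemma qs_subs f k L : qs k (map f L) =
  \sum_(t <- subs (size k) L) monomial f k t.
Proof.
elim: L k => [|x L IH] k /=.
  case: k => [|a k]; last by rewrite big_nil.
  by rewrite big_seq1 /monomial big_ord0.
rewrite big_cat -IH; congr (_ + _); case: k => [|a k] /=;
  first by rewrite big_nil.
rewrite big_map IH big_distrr; apply: eq_bigr => t _ /=.
by rewrite /monomial big_ord_recl.
Qed.

Lemma sorted_tuples_set (r : rel T) n L (D : set (n.-tuple T)) :
  transitive r -> irreflexive r -> sorted r L ->
  (forall m, D m <-> (forall i, tnth m i \in L) /\ sorted r m) ->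
  D = [set` pmap insub (subs n L) : seq (n.-tuple T)].
Proof.
move=> r_tr r_irr sL DE; apply/seteqP; split => m /=.
  move=> /DE[mL sm]; rewrite mem_pmap_sub mem_subs size_tuple eqxx /=.
  rewrite (subseq_of_sorted _ r_tr r_irr sL) sm /=.
  by apply/all_tnthP.
rewrite mem_pmap_sub mem_subs size_tuple eqxx /=.
rewrite (subseq_of_sorted _ r_tr r_irr sL) => /andP[sm /all_tnthP mL].
by apply/DE.
Qed.

(** Increasing tuples with entries in a sorted list are its subsequences, over which [qs] sums by
    recursion on the list. *)
Lemma sum_sorted_tuples (r : rel T) k L (D : set ((size k).-tuple T)) f :
  transitive r -> irreflexive r -> sorted r L ->
  (forall m, D m <-> (forall i, tnth m i \in L) /\ sorted r m) ->
  \sum_(m \in D) monomial f k m = qs k (map f L).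
Proof.
move=> r_tr r_irr sL DE; rewrite (sorted_tuples_set r_tr r_irr sL DE).
have uL := sorted_uniq r_tr r_irr sL.
rewrite -fsbig_seq; last by apply: pmap_sub_uniq; apply: subs_uniq.
rewrite -(big_map val xpredT (monomial f k)) (pmap_filter (insubK _)) qs_subs.
congr bigop; apply/all_filterP/allP => t; rewrite mem_subs => /andP[st _].
by rewrite /= isSome_insub.
Qed.

End SortedTuples.

Section Bridges.
Variable R : realType.
Implicit Types (k : seq nat).
Local Notation ms := (@ms R).
Local Notation zeta := (@zeta R).
Local Notation fs := (@fs R).
Local Notation zF := (@zF R).

Lemma monomialE (T : choiceType) (f : T -> R) k (m : (size k).-tuple T) :
  (\prod_(i < size k) f (tnth m i) ^+ nth 0%N k i)^-1 =
  monomial (fun x => (f x)^-1) k m.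
Proof.
rewrite /monomial -prodfV; apply: eq_bigr => i _.
rewrite -exprVn; congr (_ ^+ _).
by rewrite (nth_map (tnth m i)) ?size_tuple // -tnth_nth.
Qed.

Definition recip_gt (a b : int) := (a%:Q)^-1 > (b%:Q)^-1.

Definition recip_seq M : seq int :=
  [seq m%:Z | m <- iota 1 M] ++ [seq - m%:Z | m <- rev (iota 1 M)].

Lemma recip_gt_trans : transitive recip_gt.
Proof. by move=> b a c ab bc; apply: lt_trans bc ab. Qed.

Lemma recip_gt_irr : irreflexive recip_gt.
Proof. by move=> a; rewrite /recip_gt ltxx. Qed.

Lemma recip_seq_sorted M : sorted recip_gt (recip_seq M).
Proof.
have pos m : m \in iota 1 M -> 0 < m%:~R :> rat.
  by rewrite mem_iota => /andP[m0 _]; rewrite ltr0n.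
have inc a b : a \in iota 1 M -> b \in iota 1 M -> (a < b)%N ->
    (b%:~R : rat)^-1 < (a%:~R)^-1.
  by move=> /pos a0 /pos b0 ab; rewrite ltf_pV2 ?posrE // ltr_nat.
have trN : transitive (fun a b : nat => recip_gt (- b%:Z) (- a%:Z)).
  by move=> b a c ab bc; apply: recip_gt_trans bc ab.
rewrite (sorted_pairwise recip_gt_trans) pairwise_cat; apply/and3P; split.
- apply/allrelP => _ _ /mapP[a ain ->] /mapP[b bin ->].
  rewrite /recip_gt mulrNz invrN; apply: lt_trans (_ : 0 < _).
    by rewrite oppr_lt0 invr_gt0 pos // -mem_rev.
  by rewrite invr_gt0 pos.
- rewrite pairwise_map; apply: (@sub_in_pairwise _ (mem (iota 1 M)) ltn).
  + by move=> a b ain bin ab; apply: inc.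
  + by apply/allP.
  + by rewrite -(sorted_pairwise ltn_trans) iota_ltn_sorted.
- rewrite -(sorted_pairwise recip_gt_trans) sorted_map rev_sorted.
  rewrite (sorted_pairwise trN).
  apply: (@sub_in_pairwise _ (mem (iota 1 M)) ltn).
  + move=> a b ain bin ab; rewrite /= /recip_gt !mulrNz !invrN ltrN2.
    exact: inc.
  + by apply/allP.
  + by rewrite -(sorted_pairwise ltn_trans) iota_ltn_sorted.
Qed.

Lemma mem_recip_seq M (x : int) : (x \in recip_seq M) = (0 < `|x| < M.+1%:Z).
Proof.
rewrite mem_cat; apply/orP/idP => [[]|].
- by move=> /mapP[m]; rewrite mem_iota add1n => H ->.
- by move=> /mapP[m]; rewrite mem_rev mem_iota add1n => H ->; rewrite normrN.
case: x => m H.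
  by left; apply/mapP; exists m => //; rewrite mem_iota add1n.
right; apply/mapP; exists m.+1; last by rewrite NegzE.
by rewrite mem_rev mem_iota add1n; move: H; rewrite NegzE normrN.
Qed.

Lemma mzvF_truncE k M : all (leq 1) k -> mzvF_trunc R k M.+1 = fs k M.+1.
Proof.
move=> Hk; have D (m : (size k).-tuple int) : mzvF_dom (size k) M.+1 m <->
    (forall i, tnth m i \in recip_seq M) /\ sorted recip_gt m.
  by split=> -[Hm sm]; split=> // i; have := Hm i; rewrite mem_recip_seq.
rewrite fsE // -[rev _ ++ _](_ : map (fun x : int => (x%:~R : R)^-1)
  (recip_seq M) = _).
  rewrite -(sum_sorted_tuples _ recip_gt_trans recip_gt_irr (recip_seq_sorted M)
    D).
  apply: eq_fsbigr => m; rewrite inE => /D[Hm _]; exact: monomialE.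
rewrite /recip_seq map_cat /desc -map_rev revK -!map_comp; congr (_ ++ _).
by apply: eq_map => m /=; rewrite mulrNz invrN.
Qed.

Lemma mzvFE k : all (leq 1) k -> mzvF R k = zF k.
Proof.
move=> Hk; apply/cvg_lim => //.
have := @fs_cvg R _ Hk; rewrite -(cvg_shiftS (mzvF_trunc R k))
  -(cvg_shiftS (fs k)).
by apply: cvg_trans; apply: near_eq_cvg; near=> M; rewrite /= mzvF_truncE.
Unshelve. all: by end_near. Qed.

Lemma h0_enc k : admissible k -> h0 (enc (rev k)).
Proof.
move=> /andP[Hk adm]; rewrite /h0 h1_enc ?all_rev // andbT.
case/lastP: k Hk adm => // k a _;
  rewrite rev_rcons last_rcons -size_eq0 size_rcons.
by case: a => [|[|a]].
Qed.

Definition mzv_trunc k M : set ((size k).-tuple nat) :=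
  [set m | (forall i, tnth m i \in iota 1 M) /\ sorted ltn m].

#[local] Arguments mzv_trunc : clear implicits.

Definition mzv_term k (m : (size k).-tuple nat) : R :=
  (\prod_(i < size k) (tnth m i)%:R ^+ nth 0%N k i)^-1.

Lemma mzv_term_ge0 k m : 0 <= @mzv_term k m.
Proof. by rewrite invr_ge0 prodr_ge0 // => i _; rewrite exprn_ge0. Qed.

Lemma mzv_trunc_finite k M : finite_set (mzv_trunc k M).
Proof.
rewrite (@sorted_tuples_set _ ltn _ _ (mzv_trunc k M) ltn_trans ltnn
  (iota_ltn_sorted 1 M)) //.
Qed.

Lemma sum_mzv_trunc k M : all (leq 1) k ->
  \sum_(m \in mzv_trunc k M) @mzv_term k m = ms (enc (rev k)) M.+1.
Proof.
move=> Hk; rewrite ms_enc ?all_rev // -[desc R M]revK qs_rev /desc -map_rev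
  revK.
rewrite -(@sum_sorted_tuples _ _ ltn _ _ (mzv_trunc k M) _ ltn_trans ltnn
  (iota_ltn_sorted 1 M)) //.
by apply: eq_fsbigr => m _; apply: monomialE.
Qed.

(** A squeeze: any finite set of tuples lies in [mzv_trunc k M] for [M] its largest entry, and each
    [mzv_trunc k M] is itself one of the finite sets under the supremum. *)
Lemma mzvE k : admissible k -> mzv R k = zeta (enc (rev k)).
Proof.
move=> adm; have h0k := h0_enc adm; have /andP[Hk _] := adm.
have sub M : mzv_trunc k M `<=` mzv_dom (size k).
  move=> m [Hm sm]; split=> // i; have := Hm i; rewrite mem_iota.
  by case/andP.
have sumE M : (\sum_(m \in mzv_trunc k M) (@mzv_term k m)%:E)%E =
    (ms (enc (rev k)) M.+1)%:E.
  by rewrite fsumEFin ?sum_mzv_trunc //; apply: mzv_trunc_finite.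
rewrite /mzv -/(@mzv_term k).
set s := esum _ _.
have s_le : (s <= (zeta (enc (rev k)))%:E)%E.
  apply: ub_ereal_sup => _ [A [finA AD] <-].
  have [r Er] := (finite_seqP A).1 finA.
  pose M := (\max_(m <- r) \max_(i < size k) tnth m i)%N.
  have AM : A `<=` mzv_trunc k M.
    move=> m Am; have [pos sm] := AD m Am; split=> // i.
    rewrite mem_iota pos add1n ltnS.
    have mr : m \in r by move: Am; rewrite Er.
    apply: (@leq_trans (\max_(i < size k) tnth m i)).
      exact: (leq_bigmax (F := fun i => tnth m i)).
    exact: (leq_bigmax_seq (F :=
      fun t : (size k).-tuple nat => \max_(i < size k) tnth t i) m mr isT).
  apply: (@le_trans _ _ (ms (enc (rev k)) M.+1)%:E);
    last by rewrite lee_fin ms_le_zeta.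
  rewrite -sumE; apply: lee_fsum_nneg_subset => //;
    first exact: mzv_trunc_finite.
    by move=> m; rewrite !inE => /AM.
  by move=> m _; rewrite lee_fin mzv_term_ge0.
have s_ge M : ((ms (enc (rev k)) M.+1)%:E <= s)%E.
  apply: esum_ge; exists (mzv_trunc k M); last by rewrite sumE.
  by split=> //; apply: mzv_trunc_finite.
case: s s_le s_ge => [r||] //; last by move=> _ /(_ 0%N).
rewrite lee_fin => le ge; apply/eqP; rewrite eq_le le /=.
apply: limr_le; first by apply/cvg_ex; exists (zeta (enc (rev k)));
  apply: ms_cvg.
near=> M; have M0 : (0 < M)%N by near: M; exact: nbhs_infty_gt.
by rewrite -(prednK M0) -lee_fin.
Unshelve. all: by end_near. Qed.

End Bridges.

(** * The two spaces *)

Section RationalSpan.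
Variable R : realType.
Implicit Types (S : set R) (x y : R).

Lemma Qspan_gen S x : S x -> Qspan S x.
Proof.
move=> Sx; exists [:: (1, x)]; split; last by rewrite big_seq1 rmorph1 mul1r.
by move=> p; rewrite inE => /eqP->.
Qed.

Lemma Qspan0 S : Qspan S 0.
Proof. by exists [::]; split; rewrite ?big_nil. Qed.

Lemma QspanD S x y : Qspan S x -> Qspan S y -> Qspan S (x + y).
Proof.
move=> [s [Hs ->]] [t [Ht ->]]; exists (s ++ t); split; last by rewrite big_cat.
by move=> p; rewrite mem_cat => /orP[/Hs|/Ht].
Qed.

Lemma QspanZ S (q : rat) x : Qspan S x -> Qspan S (ratr q * x).
Proof.
move=> [s [Hs ->]]; exists [seq (q * p.1, p.2) | p <- s]; split.
  by move=> _ /mapP[p ps ->]; exact: (Hs p ps).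
by rewrite big_map big_distrr; apply: eq_bigr => p _ /=; rewrite rmorphM mulrA.
Qed.

Lemma QspanN S x : Qspan S x -> Qspan S (- x).
Proof. by move=> /(QspanZ (-1)); rewrite rmorphN1 mulN1r. Qed.

Lemma Qspan_sign S x n : Qspan S x -> Qspan S ((-1) ^+ n * x).
Proof.
by move=> Sx; rewrite -signr_odd; case: odd; rewrite ?mulN1r ?mul1r //;
  apply: QspanN.
Qed.

Lemma Qspan_sum S (I : eqType) (r : seq I) (f : I -> R) :
  (forall i, i \in r -> Qspan S (f i)) -> Qspan S (\sum_(i <- r) f i).
Proof.
elim: r => [|i r IH] H; first by rewrite big_nil; apply: Qspan0.
rewrite big_cons; apply: QspanD; first by apply: H; rewrite mem_head.
by apply: IH => j jr; apply: H; rewrite inE jr orbT.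
Qed.

Lemma Qspan_subset S S' : S `<=` Qspan S' -> Qspan S `<=` Qspan S'.
Proof.
move=> H x [s [Hs ->]]; apply: Qspan_sum => p ps; apply: QspanZ.
exact/H/Hs.
Qed.

Lemma Qspan_mul S1 S2 S3 :
  (forall x y, S1 x -> S2 y -> Qspan S3 (x * y)) ->
  forall x y, Qspan S1 x -> Qspan S2 y -> Qspan S3 (x * y).
Proof.
move=> H x y [s [Hs ->]] [t [Ht ->]]; rewrite big_distrl.
apply: Qspan_sum => p ps /=; rewrite big_distrr; apply: Qspan_sum => q qt /=.
rewrite mulrACA -rmorphM; apply: QspanZ; apply: H; [exact: Hs | exact: Ht].
Qed.

End RationalSpan.

Section Spaces.
Variable R : realType.
Implicit Types (k : seq nat) (u v x : seq bool) (w : nat).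
Local Notation zeta := (@zeta R).
Local Notation z1 := (@z1 R).
Local Notation zsh := (@zsh R).
Local Notation zF := (@zF R).

Definition Zspace w := Qspan [set zeta x | x in [set x | h0 x /\ size x = w]].
Definition Fspace w := Qspan
  [set zF k | k in [set k | all (leq 1) k /\ sumn k = w]].

Lemma mzv_spaceE w : mzv_space R w = Zspace w.
Proof.
congr Qspan; apply/seteqP; split => _ [x [Hx Hw] <-].
  exists (enc (rev x)); last by rewrite mzvE.
  by split; [exact: h0_enc | rewrite size_enc ?all_rev ?sumn_rev //;
    case/andP: Hx].
have h1x : h1 x by case/andP: Hx.
have [k [Hk E]] := enc_surj h1x.
have adm : admissible (rev k).
  rewrite /admissible /is_index all_rev Hk /=.
  case: k Hk E => // a k /andP[a0 _] E; rewrite rev_cons last_rcons; apply/orP;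
    right.
  by case: a a0 E Hx => [|[|a]] // _ <-.
exists (rev k); last by rewrite mzvE // revK E.
by split=> //; rewrite /weight sumn_rev -size_enc // E.
Qed.

Lemma mzvF_spaceE w : mzvF_space R w = Fspace w.
Proof.
congr Qspan; apply/seteqP; split => _ [k [Hk Hw] <-]; exists k;
  rewrite ?mzvFE //.
Qed.

Lemma Zspace_zeta x : h0 x -> Zspace (size x) (zeta x).
Proof. by move=> h0x; apply: Qspan_gen; exists x. Qed.

Lemma Zspace_mul i j (x y : R) : Zspace i x -> Zspace j y ->
  Zspace (i + j) (x * y).
Proof.
apply: Qspan_mul => _ _ [u [h0u <-] <-] [v [h0v <-] <-].
rewrite zeta_mul //; apply: Qspan_sum => z zin.
by rewrite -(size_sh zin); apply: Zspace_zeta; apply: h0_sh zin.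
Qed.

Lemma Zspace_z1 u : h1 u -> Zspace (size u) (z1 u).
Proof.
have [x [Eu lx]] := leadP true u; move: (lead true u) Eu => n ->{u} Hu.
case: x lx Hu => [|c x] /eqP lx Hu.
  rewrite cats0 z1_nseq size_nseq; case: n {Hu} => [|n]; last exact: Qspan0.
  by rewrite -[true%:R](zeta_nil R); apply: (@Zspace_zeta [::]).
have cF : c = false by move: lx; rewrite lead0_cons; case: (c).
rewrite cF in Hu *.
have x0 : x != [::] by move: Hu; rewrite /h1 last_cat; case: (x).
have h1x : h1 x by move: Hu x0; rewrite /h1 last_cat /=; case: (x).
rewrite /z1 ext_nseq_cat //; apply: Qspan_sign; apply: Qspan_sum => y yin.
have h1n : h1 (nseq n true) by rewrite /h1; elim: (n).
have h1y := h1_sh h1n h1x yin; have sy := size_sh yin.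
have -> : size (nseq n true ++ false :: x) = size (false :: y).
  by rewrite size_cat /= sy addnS.
apply: Zspace_zeta; rewrite /h0 /= /h1; case: y sy h1y {yin} => // sy _.
by move: x0; rewrite -size_eq0; move: sy => /= /esym /eqP;
  rewrite addn_eq0 => /andP[_ ->].
Qed.

Lemma Zspace_zsh u : Zspace (size u) (zsh u).
Proof.
rewrite /zsh -(size_rev u); move: (rev u) => {}u.
have [x [Eu lx]] := leadP false u; move: (lead false u) Eu => n ->{u}.
case: x lx => [_|c x /eqP]; first rewrite cats0 ext_nseq size_nseq.
  case: n => [|n]; last exact: Qspan0.
  by rewrite -[true%:R](zeta_nil R); apply: (@Zspace_zeta [::]).
rewrite lead0_cons => cF; rewrite ext_nseq_cat //.
apply: Qspan_sign; apply: Qspan_sum => y yin.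
have -> : size (nseq n false ++ c :: x) = size (rev (c :: y)).
  by rewrite size_rev size_cat /= (size_sh yin) addnS.
by apply: Zspace_z1; rewrite /h1 rev_cons last_rcons; case: (c) cF.
Qed.

Lemma Zspace_ones_lim s : Zspace s (ones_lim R s).
Proof.
rewrite /ones_lim; case: ifP => [_|/negbT ev]; first exact: Qspan0.
apply: Qspan_sign; have := Zspace_zeta (h0_enc_nseq2 s./2).
by rewrite size_enc ?all_nseq ?orbT // sumn_nseq mul2n even_halfK.
Qed.

Lemma sumn_ones k p q : (q <= size k)%N -> ones k p q ->
  (sumn (take p k) + (q - p) + sumn (drop q k))%N = sumn k.
Proof.
move=> qk O; rewrite -{3}(cat_take_drop p k) sumn_cat (ones_sumn qk O).
by rewrite addnA.
Qed.

Lemma Zspace_lower k p : all (leq 1) k ->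
  Zspace (sumn (take p k)) (lower R k p).
Proof.
rewrite -{1}(cat_take_drop p k) all_cat => /andP[Hp _].
rewrite -sumn_rev -size_enc ?all_rev //; apply: Zspace_z1.
by apply: h1_enc; rewrite all_rev.
Qed.

Lemma Zspace_upper k q : all (leq 1) k ->
  Zspace (sumn (drop q k)) (upper R k q).
Proof.
rewrite -{1}(cat_take_drop q k) all_cat => /andP[_ Hq].
by rewrite -size_enc //; apply: Zspace_z1; apply: h1_enc.
Qed.

(** The three factors of each surviving term of [zF] have total weight [w] by [sumn_ones]. *)
Lemma Fspace_sub_Zspace w : Fspace w `<=` Zspace w.
Proof.
apply: Qspan_subset => _ [k [Hk <-] <-].
apply: Qspan_sum => p _; apply: Qspan_sum => q;
  rewrite mem_index_iota ltnS => /andP[_ qk].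
case O : (ones k p q); last by rewrite !mul0r; apply: Qspan0.
rewrite mul1r -mulrA; apply: Qspan_sign; rewrite -(sumn_ones qk O) mulrAC.
apply: Zspace_mul; last exact: Zspace_upper.
by apply: Zspace_mul; [exact: Zspace_lower | exact: Zspace_ones_lim].
Qed.

(** Exact at every truncation, where all values are quasi-symmetric sums in one list of variables;
    then the limit is taken. *)
Lemma zF_mul k l : all (leq 1) k -> all (leq 1) l ->
  zF k * zF l = \sum_(t <- stuffle k l) zF t.
Proof.
move=> Hk Hl.
have lim1 : (fun M => fs R k M * fs R l M) @ \oo --> zF k * zF l.
  by apply: cvgM; apply: fs_cvg.
have lim2 : (fun M => \sum_(t <- stuffle k l) fs R t M) @ \oo -->
  \sum_(t <- stuffle k l) zF t.
  by apply: cvgn_sum => t tin; apply: fs_cvg; apply: st_index tin.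
suff lim3 : (fun M => \sum_(t <- stuffle k l) fs R t M) @ \oo --> zF k * zF l.
  exact: (cvg_unique (@norm_hausdorff _ _) lim3 lim2).
rewrite -(cvg_shiftS (fun M => \sum_(t <- stuffle k l) fs R t M)).
move: lim1; rewrite -(cvg_shiftS (fun M => fs R k M * fs R l M)).
apply: cvg_trans; apply: near_eq_cvg; near=> M.
rewrite /= !fsE // qs_mul big_seq [RHS]big_seq; apply: eq_bigr => t tin.
by rewrite fsE //; apply: st_index tin.
Unshelve. all: by end_near. Qed.

Lemma Fspace_mul i j (x y : R) : Fspace i x -> Fspace j y ->
  Fspace (i + j) (x * y).
Proof.
apply: Qspan_mul => _ _ [k [Hk <-] <-] [l [Hl <-] <-].
rewrite zF_mul //; apply: Qspan_sum => t tin; apply: Qspan_gen; exists t => //.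
by split; [exact: st_index tin | exact: st_weight tin].
Qed.

Definition Fpred w : {pred R} := fun r => `[< Fspace w r >].

Lemma Fpred_closed w : zmod_closed (Fpred w).
Proof.
split; first by apply/asboolP; apply: Qspan0.
move=> x y /asboolP Fx /asboolP Fy; apply/asboolP.
by apply: QspanD => //; apply: QspanN.
Qed.

HB.instance Definition _ w :=
  GRing.isZmodClosed.Build R (Fpred w) (Fpred_closed w).

(** Only the additive quotient is formed; rational scalars survive as torsion-freeness, which is
    what [symmetric_vanish] asks for. *)
Definition Fquot w := Quotient.quot (Fpred w : zmodClosed R).
HB.instance Definition _ w := GRing.Zmodule.on (Fquot w).

Definition pi w : R -> Fquot w := \pi_(Fquot w)%qT.

Lemma pi_zmod_morphism w : zmod_morphism (pi w).
Proof. by move=> x y; rewrite /pi raddfB. Qed.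

HB.instance Definition _ w :=
  GRing.isZmodMorphism.Build R (Fquot w) (pi w) (pi_zmod_morphism w).

Lemma pi_eq0 w (x : R) : pi w x = 0 <-> Fspace w x.
Proof.
rewrite -(raddf0 (pi w)); split => [/eqP|Fx].
  by rewrite -Quotient.idealrBE subr0 => /asboolP.
by apply/eqP; rewrite -Quotient.idealrBE subr0; apply/asboolP.
Qed.

Lemma quot_torsion_free w (v : Fquot w) n : v *+ n.+1 = 0 -> v = 0.
Proof.
rewrite -[v]reprK -raddfMn /= => /pi_eq0 /(QspanZ (n.+1%:R^-1)) H; apply/pi_eq0.
by move: H; rewrite fmorphV rmorph_nat -(mulr_natl (repr v)) mulKf ?pnatr_eq0.
Qed.

Lemma enc_cat k l : enc (k ++ l) = enc k ++ enc l.
Proof. by rewrite /enc map_cat flatten_cat. Qed.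

(** With one more [true] in front, every block is delimited on both sides, so reversing the blocks
    reverses the word. *)
Lemma enc_rev k : all (leq 1) k -> true :: enc (rev k) = rev (true :: enc k).
Proof.
elim: k => // -[//|a] k IH /= Hk.
rewrite rev_cons -cats1 enc_cat -cat_cons IH // !enc_cons.
rewrite -[true :: nseq a false ++ _]cat_cons rev_cat rev_cons; congr (_ ++ _).
by rewrite rev_cons rev_nseq cats1.
Qed.

Lemma size_le_sumn k : all (leq 1) k -> (size k <= sumn k)%N.
Proof.
by elim: k => //= a k IH /andP[a0 /IH]; rewrite -add1n; apply: leq_add.
Qed.

Lemma sum_delta (V : nmodType) n i j (A : V) : (i <= n)%N -> (j <= n)%N ->
  \sum_(0 <= p < n.+1) \sum_(0 <= q < n.+1)
    (if (p == i) && (q == j) then A else 0) = A.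
Proof.
move=> ilen jlen; have lei : (i < n.+1)%N by [].
have lej : (j < n.+1)%N by [].
rewrite big_mkord (bigD1 (Ordinal lei)) //=.
rewrite big_mkord (bigD1 (Ordinal lej)) //= !eqxx /= !big1 ?addr0 // => p.
  by rewrite -val_eqE /= => /negbTE ->; rewrite big1.
by rewrite -val_eqE /= => /negbTE ->.
Qed.

(** The corners [p = q = n] and [p = q = 0] of the double sum give the two single values. Every
    other nonzero term is a product of three factors of weight below [w], since [k] does not consist
    of ones only. *)
Lemma zF_mod_products w k : (0 < w)%N -> all (leq 1) k -> sumn k = w ->
  k != nseq w 1%N -> (forall j, (j < w)%N -> Zspace j `<=` Fspace j) ->
  Fspace w (zF k - (z1 (enc (rev k)) + (-1) ^+ w * z1 (enc k))).
Proof.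
move=> w0 Hk Hw k1 IH; set n := size k.
have n0 : (0 < n)%N by rewrite lt0n size_eq0; apply: contraTneq w0 => k0;
  rewrite -Hw k0.
pose d p q : R := (if (p == n) && (q == n) then z1 (enc (rev k)) else 0) +
  (if (p == 0%N) && (q == 0%N) then (-1) ^+ w * z1 (enc k) else 0).
have -> : z1 (enc (rev k)) + (-1) ^+ w * z1 (enc k) =
    \sum_(0 <= p < n.+1) \sum_(0 <= q < n.+1) d p q.
  rewrite /d; under eq_bigr do rewrite big_split.
  rewrite big_split /=; congr (_ + _).
    by rewrite sum_delta.
  by rewrite sum_delta.
rewrite -sumrB; apply: Qspan_sum => p;
  rewrite mem_index_iota ltnS => /andP[_ pn].
rewrite -sumrB; apply: Qspan_sum => q;
  rewrite mem_index_iota ltnS => /andP[_ qn].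
have ones_id r : ones k r r by rewrite /ones leqnn subnn take0.
have lim0 : ones_lim R 0 = 1 by rewrite /ones_lim mul1r zeta_nil.
case: (boolP ((p == n) && (q == n))) => [/andP[/eqP pE /eqP qE]|nn].
  rewrite /d pE qE !eqxx gtn_eqF //= addr0 ones_id mul1r subnn lim0 mulr1.
  rewrite /lower /upper take_size drop_size z1_nil mulr1 mul1r subrr.
  exact: Qspan0.
case: (boolP ((p == 0%N) && (q == 0%N))) => [/andP[/eqP pE /eqP qE]|n00].
  rewrite /d pE qE !eqxx ltn_eqF //= add0r ones_id mul1r subnn lim0 mulr1.
  rewrite /lower /upper take0 drop0 z1_nil mul1r Hw subrr.
  exact: Qspan0.
rewrite /d (negbTE nn) (negbTE n00) addr0 subr0.
case O : (ones k p q); last by rewrite !mul0r; apply: Qspan0.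
have pq : (p <= q)%N by case/andP: O.
have E := sumn_ones qn O; rewrite Hw in E.
have [Ht Hd] : all (leq 1) (take p k) /\ all (leq 1) (drop q k).
  split; first by move: Hk; rewrite -{1}(cat_take_drop p k) all_cat => /andP[].
  by move: Hk; rewrite -{1}(cat_take_drop q k) all_cat => /andP[].
have pa : (p <= sumn (take p k))%N by rewrite -{1}(size_takel pn) size_le_sumn.
have qb : (n - q <= sumn (drop q k))%N by rewrite -size_drop size_le_sumn.
(* Entries are at least 1, so weights bound lengths: a prefix of full weight would force
   [p = q = n], and a suffix of full weight [p = q = 0]. *)
have a_lt : (sumn (take p k) < w)%N.
  rewrite ltnNge; apply: contra nn => ge; lia.
have b_lt : (sumn (drop q k) < w)%N.
  rewrite ltnNge; apply: contra n00 => ge; lia.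
have s_lt : (q - p < w)%N.
  rewrite ltnNge; apply: contra k1 => ge.
  have p0 : p = 0%N by lia.
  have qE : q = n by lia.
  move: O; rewrite /ones p0 qE subn0 drop0 take_size => /andP[_ /all_pred1P ->].
  by rewrite -/n; apply/eqP; congr nseq; lia.
rewrite mul1r -mulrA; apply: Qspan_sign; rewrite -E mulrAC.
apply: Fspace_mul; last by apply: IH => //; apply: Zspace_upper.
apply: Fspace_mul; apply: IH => //;
  [exact: Zspace_lower | exact: Zspace_ones_lim].
Qed.

Lemma Zspace_sub_step w : (1 < w)%N ->
  (forall j, (j < w)%N -> Zspace j `<=` Fspace j) -> Zspace w `<=` Fspace w.
Proof.
move=> w1 IH; have w0 := ltnW w1.
apply: Qspan_subset => _ [x [h0x Hx] <-]; apply/pi_eq0.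
have h0_zsh y : h0 y -> zsh y = zeta y.
  by move=> h0y; rewrite zsh_h1 ?z1_h0 //; case/andP: h0y.
rewrite -h0_zsh //.
apply: (symmetric_vanish (@quot_torsion_free w) (g := fun y => pi w (zsh y))
  w1) => //.
- move=> u v u0 v0 Hs; rewrite -(raddf_sum (pi w)) -zsh_mul; apply/pi_eq0.
  rewrite -Hs; apply: Fspace_mul; (apply: IH; last exact: Zspace_zsh).
    by rewrite -Hs -[ltnLHS]addn0 ltn_add2l lt0n size_eq0.
  by rewrite -Hs -[ltnLHS]add0n ltn_add2r lt0n size_eq0.
- move=> y Hy h0y; rewrite !h0_zsh ?zeta_dual //; exact: h0_dual.
move=> u Hu.
have h1u : h1 (rcons u true) by rewrite /h1 last_rcons.
have [k [Hk Ek]] := enc_surj h1u.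
have Erev : enc (rev k) = rcons (rev u) true.
  by have := enc_rev Hk; rewrite Ek rev_cons rev_rcons /= => -[].
have Hw : sumn k = w by rewrite -size_enc // Ek size_rcons.
have h1r : h1 (rcons (rev u) true) by rewrite /h1 last_rcons.
rewrite !zsh_h1 // -Erev -Ek.
(* The index of ones, excluded from [zF_mod_products], needs no relation: [z1] vanishes on both
   words. *)
have [k1|k1] := eqVneq k (nseq w 1%N).
  have encE m : enc (nseq m 1%N) = nseq m true by elim: m => //= m IHm;
    rewrite enc_cons IHm.
  by rewrite k1 rev_nseq encE z1_nseq -(prednK w0) raddf0 mul0rz.
have /pi_eq0 := zF_mod_products w0 Hk Hw k1 IH.
rewrite raddfB /= (_ : pi w (zF k) = 0); last by apply/pi_eq0; apply: Qspan_gen;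
  exists k.
move/eqP; rewrite sub0r oppr_eq0 raddfD addr_eq0 => /eqP ->.
have -> : (-1) ^+ w = - (-1) ^+ w.-1 :> R.
  by rewrite -{1}(prednK w0) exprS mulN1r.
rewrite mulNr raddfN opprK -signr_odd -[in RHS]signr_odd.
by case: odd; rewrite ?expr1 ?expr0 ?mulN1r ?mul1r ?raddfN ?mulrN1z ?mulr1z.
Qed.

Lemma Zspace_sub_Fspace w : Zspace w `<=` Fspace w.
Proof.
elim/ltn_ind: w => w IH.
(* Weights 0 and 1 are treated apart, as [cyclic_vanish] starts at 2; no word of length 1 is in
   [h0]. *)
case: w IH => [|[|w]] IH; last exact: Zspace_sub_step.
- apply: Qspan_subset => _ [x [h0x /size0nil ->] <-].
  apply: Qspan_gen; exists [::] => //.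
  by rewrite /zF !big_nat1 /lower /upper /ones_lim /= z1_nil zeta_nil !mul1r.
- by apply: Qspan_subset => _ [[|[] [|b x]] [h0x Hx] <-].
Qed.

End Spaces.

Theorem theorem6p1 (R : realType) (k : nat) : mzvF_space R k = mzv_space R k.
Proof.
rewrite mzv_spaceE mzvF_spaceE; apply/seteqP.
by split; [exact: Fspace_sub_Zspace | exact: Zspace_sub_Fspace].
Qed.
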